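(* Let $c>0$ and let $H_n$ be the ultrametric ensemble with parameter $c$ described in the context, and let $E\in\mathbb{R}$. Then there exist $w,\mu,\kappa>0$, $C<\infty$, and a sequence of integers $m_n$ with $n-m_n\to\infty$ such that for all $n$ and every $x\in B_n$, \[\mathbb{P}\Big(\sum_{y\in B_n\setminus B_{m_n}(x)} Q_n(x,y;W)>2^{-\mu n}\Big)\le C\,2^{-\kappa n},\qquad W=\big[E-2^{-(1-w)n},\,E+2^{-(1-w)n}\big].\]
   Context: Let $B_n=\{1,\dots,2^n\}$. For $0\le r\le n$ let $\mathcal{P}_r$ be the partition of $B_n$ into the $2^{n-r}$ consecutive blocks $\{1,\dots,2^r\},\{2^r+1,\dots,2\cdot 2^r\},\dots$, and let $d(x,y)=\min\{r\ge 0: x,y \text{ lie in a common block of }\mathcal{P}_r\}$; $B_m(x)=\{y\in B_n: d(x,y)\le m\}$ denotes the block of $\mathcal{P}_m$ containing $x$. For $0\le r\le n$, $\Phi_{n,r}$ is a real symmetric random matrix on $\ell^2(B_n)$ whose entries are independent (up to symmetry) centered real Gaussians with $\mathbb{E}|\langle\delta_y,\Phi_{n,r}\delta_x\rangle|^2=2^{-r}\cdot 2$ if $x=y$, $=2^{-r}$ if $1\le d(x,y)\le r$, and $=0$ otherwise; the $\Phi_{n,r}$, $r=0,\dots,n$, are independent. The ultrametric ensemble with parameter $c$ is $H_n=Z_{n,c}^{-1}\sum_{r=0}^n 2^{-(1+c)r/2}\Phi_{n,r}$ with $Z_{n,c}>0$ chosen so that $\sum_{y}\mathbb{E}|\langle\delta_y,H_n\delta_x\rangle|^2=1$.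 With $\{\psi_\lambda\}$ an orthonormal basis of ($\ell^2$-normalized) eigenfunctions of $H_n$, the eigenfunction correlator is $Q_n(x,y;W)=\sum_{\lambda\in\sigma(H_n)\cap W}|\psi_\lambda(x)\psi_\lambda(y)|$. *)

(* Defs.v *)
From HB Require Import structures.
From mathcomp Require Import all_boot all_order all_algebra.
From mathcomp Require Import all_classical all_reals all_analysis.
Set Implicit Arguments. Unset Strict Implicit. Unset Printing Implicit Defensive.
Import Order.TTheory GRing.Theory Num.Theory.
Local Open Scope classical_set_scope.
Local Open Scope ring_scope.

(* Points of B_n = {1,...,2^n} are represented 0-based by 'I_(2^n)
   (point k+1 of the paper <-> ordinal k).  The blocks of P_r are then
   {x | x %/ 2^r = j}. *)

Lemma same_block_exists (x y : nat) : exists r, ((x %/ 2 ^ r) == (y %/ 2 ^ r))%N.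
Proof.
exists (x + y).
have hx : (x < 2 ^ (x + y))%N.
  by apply: (leq_trans (ltn_expl x (isT : (1 < 2)%N))); rewrite leq_exp2l // leq_addr.
have hy : (y < 2 ^ (x + y))%N.
  by apply: (leq_trans (ltn_expl y (isT : (1 < 2)%N))); rewrite leq_exp2l // leq_addl.
by rewrite (divn_small hx) (divn_small hy).
Qed.

Definition udist (x y : nat) : nat := ex_minn (same_block_exists x y).

Definition in_ball (m : int) (x y : nat) : bool := ((udist x y)%:Z <= m)%R.

Definition phi_var {R : realType} (r x y : nat) : R :=
  if x == y then 2 `^ (- (r%:R)) * 2
  else if (1 <= udist x y <= r)%N then 2 `^ (- (r%:R)) else 0.

Definition gidx (n : nat) : finType := ('I_n.+1 * 'I_(2 ^ n) * 'I_(2 ^ n))%type.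

(* Phi_{n,r}(x,y) realized as sqrt(variance) * g(r, min x y, max x y):
   entries are centered Gaussians with the prescribed variances, independent
   up to symmetry. *)
Definition Phi {R : realType} {T : Type} (n : nat) (g : gidx n -> T -> R)
  (r : 'I_n.+1) (x y : 'I_(2 ^ n)) (t : T) : R :=
  Num.sqrt (phi_var r x y) *
  g (r, if (x <= y)%N then x else y, if (x <= y)%N then y else x) t.

Definition Hmat {R : realType} {T : Type} (n : nat) (c Z : R)
  (g : gidx n -> T -> R) (t : T) : 'M[R]_(2 ^ n) :=
  \matrix_(x, y) (Z^-1 * \sum_(r < n.+1)
       2 `^ (- ((1 + c) * r%:R / 2)) * Phi g r x y t).

(* normalization: sum_y E|<delta_y, H_n delta_x>|^2 = 1 for every x *)
Definition is_normalization {R : realType} (n : nat) (c Z : R) : Prop :=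
  0 < Z /\ forall x : 'I_(2 ^ n),
    \sum_(y < 2 ^ n) \sum_(r < n.+1)
       (2 `^ (- ((1 + c) * r%:R / 2))) ^+ 2 * phi_var r x y = Z ^+ 2.

Definition eigenbasis {R : realType} (N : nat) (H U : 'M[R]_N) (lam : 'I_N -> R)
  : Prop :=
  U^T *m U = 1%:M /\ H *m U = U *m diag_mx (\row_k lam k).

Definition Qcorr {R : realType} (N : nat) (U : 'M[R]_N) (lam : 'I_N -> R)
  (a b : R) (x y : 'I_N) : R :=
  \sum_(k < N | lam k \in `[a, b]) `|U x k * U y k|.

Definition mutually_independent {R : realType} (d : measure_display)
  (T : measurableType d) (P : probability T R) (I : finType) (X : I -> T -> R)
  : Prop :=
  forall B : I -> set R, (forall i, measurable (B i)) ->
    P (\bigcap_(i in [set: I]) (X i @^-1` B i)) =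
    (\prod_(i : I) P (X i @^-1` B i))%E.

Definition std_gaussian {R : realType} (d : measure_display)
  (T : measurableType d) (P : probability T R) (X : T -> R) : Prop :=
  measurable_fun setT X /\
  forall A : set R, measurable A -> P (X @^-1` A) = normal_prob 0 1 A.

(* Main.v *)
(** Let [B] be the block of size [2^m] around [x], where [m = n - n/q] for a
    large constant [q], and write [H = H0 + K], where [H0] is [H] with the
    entries joining [B] to its complement erased.  [K] is independent of [H0]
    and its entries have variance at most [(n+1) 2^{-(2+c)m}], far below
    [2^{-2n}], although the norm of [K] need not be small compared with the
    level spacing [2^{-n}].

    Everything is read off the diagonal of the squared resolvents
    [S_A(eta) = ((A - E)^2 + eta^2)^{-1}], which are rational in the entries.
    By the rank-one formula and the independent diagonal Gaussians, the mean of
    [eta S_A(eta)(z,z)] is bounded for [A = H] and for [A = H0] (Wegner).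
    If [eta] is half the window, Cauchy-Schwarz bounds the square of the sum of
    correlators by [4 2^n eta^4 Tr(S_H(eta)) S_H(eta)(x,x)], so it remains to
    gain a power of [2^{-n}] over Wegner for [S_H(eta)(x,x)] outside a small
    event.  For [H0] the gain comes from the spectrum of the block, which with
    high probability stays at a distance [eta' >> eta] from [E].
    It is transferred to [H] by measuring the resolvent equation
    [(H0 - E - i eta) f = e_x - K f] in the norm with weight
    [W ~ |H0 - E - i eta|^{-1}]: there the relevant size of [K] is
    [Tr(W K W K)], whose mean given [H0] is at most a constant times
    [(n+1) 2^{-(2+c)m} (Tr W)^2], and [Tr W] is of order [n 2^n]. *)

(* Wegner bounds first moments only, whereas the mean of [Tr(W K W K)] given [H0] is controlled by
   [(Tr W)^2]. So [Tr(W K W K)] is divided by [(Tr W)^2] before averaging, and Markov's inequality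
   is applied to the ratio and to [Tr W] separately. The averaging runs over the entries of [K] with
   [W] frozen, which works because [W] depends on [H0] alone and measurably.

   Exponents, with N = 2^n: the window is eta = N^(-1+al), the gap is eta' = N^(-1+6al), the block
   has about N^(1-8al) points, and each Markov bound loses a = N^al. Wegner alone bounds the squared
   correlator sum by a^2 N^2 eta^2 = N^(4al), which is useless. Replacing a/eta by a/eta' in the
   bound on [S(x,x)] gains eta/eta' = N^(-5al) and leaves N^(-al). The gap is available since a eta'
   N^(1-8al) = N^(-al). Up to factors a and n+1, tau is N^2 2^(-(2+c)m), about N^(-c+8al(2+c)); for
   small al this is a negative power of N, and this is where c > 0 enters. *)
Require Import Defs.
From HB Require Import structures.
From mathcomp Require Import all_boot all_order all_algebra.
From mathcomp Require Import all_classical all_reals all_analysis measurable_realfun.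
From mathcomp Require Import ring lra complex.
Set Implicit Arguments. Unset Strict Implicit. Unset Printing Implicit Defensive.
Import Order.TTheory GRing.Theory Num.Theory.
Import numFieldNormedType.Exports.
Local Open Scope classical_set_scope.
Local Open Scope ring_scope.

(** * Resampling one coordinate of a Gaussian family *)

Section Resampling.
Context {R : realType} {I : finType}.
Local Notation Y := (#|I|.-tuple R).

(** Tuples carry the product sigma-algebra, so measurability of a function of the whole Gaussian
    family is expressed by precomposing with this map. *)
Definition of_tuple (y : Y) : I -> R := fun i => tnth y (enum_rank i).

Definition coord_measurable (F : (I -> R) -> R) : Prop :=
  measurable_fun [set: Y] (F \o of_tuple).

Definition upd (h : I -> R) (i : I) (x : R) : I -> R :=
  fun j => if j == i then x else h j.

Lemma coord_measurable_proj i : coord_measurable (fun h => h i).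
Proof. exact: measurable_tnth. Qed.

Let box (B : I -> set R) : set Y := [set y | forall i, B i (of_tuple y i)].

Let boxes : set (set Y) :=
  [set A | exists2 B : I -> set R, (forall i, measurable (B i)) & A = box B].

Let measurable_box B : (forall i, measurable (B i)) -> measurable (box B).
Proof.
move=> mB.
have -> : box B = \bigcap_(i in [set: I]) (of_tuple^~ i @^-1` B i).
  by apply/seteqP; split=> y By i; [move=> _; exact: By|exact: By].
apply: fin_bigcap_measurable; first exact: finite_finset.
by move=> i _; rewrite -[X in measurable X]setTI; exact: measurable_tnth.
Qed.

Let boxes_generate : (measurable : set (set Y)) = <<s boxes >>.
Proof.
apply/seteqP; split; last first.
  apply: smallest_sub; first exact: sigma_algebra_measurable.
  by move=> _ [B mB ->]; exact: measurable_box.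
apply: smallest_sub; first exact: smallest_sigma_algebra.
apply: (big_ind (fun X : set (set Y) => X `<=` <<s boxes >>)).
- by [].
- by move=> A B sA sB; rewrite subUset.
- move=> k _ A [C mC <-]; apply: sub_sigma_algebra.
  exists (fun i => if i == enum_val k then C else setT).
    by move=> i; case: ifP.
  rewrite setTI; apply/seteqP; split=> y /=.
    by move=> Cy i; case: eqP => // ->; rewrite /of_tuple enum_valK.
  by move=> /(_ (enum_val k)); rewrite eqxx /of_tuple enum_valK.
Qed.

Context {d : measure_display} {T : measurableType d} (P : probability T R).
Variable g : I -> T -> R.
Hypothesis gauss_g : forall i, std_gaussian P (g i).
Hypothesis indep_g : mutually_independent P g.

Let measurable_g i : measurable_fun [set: T] (g i).
Proof. by have [] := gauss_g i. Qed.

Let G (t : T) : Y := [tuple g (enum_val k) t | k < #|I|].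

Let of_tupleG t : of_tuple (G t) = g^~ t.
Proof. by apply/funext => i; rewrite /of_tuple tnth_mktuple enum_rankK. Qed.

Let measurable_G : measurable_fun [set: T] G.
Proof.
apply/measurable_fun_tnthP => k; rewrite [X in measurable_fun _ X](_ : _ = g (enum_val k)) //.
by apply/funext => t /=; rewrite tnth_mktuple.
Qed.

Let mG : {mfun T >-> Y} := HB.pack G (isMeasurableFun.Build _ _ _ _ G measurable_G).

Let law_box B : (forall i, measurable (B i)) ->
  distribution P mG (box B) = (\prod_i normal_prob 0 1 (B i))%E.
Proof.
move=> mB; rewrite /distribution /pushforward.
have -> : mG @^-1` box B = \bigcap_(i in [set: I]) (g i @^-1` B i).
  apply/seteqP; split=> t /= tB i; first by move=> _; have := tB i; rewrite of_tupleG.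
  by rewrite of_tupleG; exact: tB.
rewrite indep_g//; apply: eq_bigr => i _.
by have [_ ->] := gauss_g i.
Qed.

Local Notation gaussian := (normal_prob 0 1 : probability (measurableTypeR R) R).

Let U (i : I) (xy : measurableTypeR R * Y) : Y :=
  [tuple upd (of_tuple xy.2) i xy.1 (enum_val k) | k < #|I|].

Let of_tupleU i xy : of_tuple (U i xy) = upd (of_tuple xy.2) i xy.1.
Proof. by apply/funext => j; rewrite /of_tuple tnth_mktuple enum_rankK. Qed.

Let measurable_U i : measurable_fun [set: measurableTypeR R * Y] (U i).
Proof.
apply/measurable_fun_tnthP => k.
have [->|ki] := eqVneq i (enum_val k).
  rewrite [X in measurable_fun _ X](_ : _ = fst); first exact: measurable_fst.
  by apply/funext => t /=; rewrite tnth_mktuple /upd eqxx.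
rewrite [X in measurable_fun _ X](_ : _ = (@tnth _ R)^~ k \o snd).
  by apply: measurableT_comp => //; exact: measurable_tnth.
apply/funext => t /=; rewrite tnth_mktuple /upd eq_sym (negbTE ki).
by rewrite /of_tuple enum_valK.
Qed.

Let mU i : {mfun (measurableTypeR R * Y)%type >-> Y} :=
  HB.pack (U i) (isMeasurableFun.Build _ _ _ _ (U i) (measurable_U i)).

(** Boxes form a generating pi-system. On a box independence makes the law a product, and
    overwriting coordinate [i] trades its factor for that of a fresh Gaussian with the same law. *)
Let law_resampled i (A : set Y) : measurable A ->
  distribution P mG A = distribution (gaussian \x distribution P mG)%E (mU i) A.
Proof.
move=> mA.
apply: (@measure_unique _ R Y boxes (fun=> setT)) => //.
- move=> _ _ [B mB ->] [C mC ->]; exists (fun i => B i `&` C i).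
    by move=> j; exact: measurableI.
  apply/seteqP; split=> y /=; first by case=> yB yC j; split.
  by move=> yBC; split=> j; case: (yBC j).
- by move=> _; exists (fun=> setT) => //; apply/seteqP; split.
- by rewrite bigcup_const.
- move=> _ [B mB ->].
  pose B' j := if j == i then setT else B j.
  have preimU : mU i @^-1` box B = B i `*` box B'.
    apply/seteqP; split=> -[x y] /=.
      move=> h; split=> [|j]; first by have := h i; rewrite of_tupleU /upd eqxx.
      rewrite /B'; case: (eqVneq j i) => // ji.
      by have := h j; rewrite of_tupleU /upd (negbTE ji).
    move=> [Bx h] j; rewrite of_tupleU /upd.
    by case: (eqVneq j i) => [->//|ji]; have := h j; rewrite /B' (negbTE ji).
  rewrite [RHS](f_equal (gaussian \x distribution P mG)%E preimU).
  have mB' j : measurable (B' j) by rewrite /B'; case: ifP.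
  rewrite product_measure1E//; last exact: measurable_box.
  apply: etrans (law_box mB) _; rewrite (bigD1 i)//=; congr (_ * _)%E.
  apply: esym; apply: etrans (law_box mB') _.
  rewrite (bigD1 i)//= /B' eqxx.
  rewrite -[X in (X * _)%E]/(gaussian setT) probability_setT mul1e.
  by apply: eq_bigr => j /negbTE ->.
- exact: (mB i).
- by move=> k; exact: le_lt_trans (probability_le1 (distribution P mG) measurableT) (ltry _).
Qed.

Lemma coord_measurable_comp F : coord_measurable F ->
  measurable_fun [set: T] (fun t => F (g^~ t)).
Proof.
move=> mF; rewrite (_ : (fun _ => _) = (F \o of_tuple) \o G).
  exact: measurableT_comp.
by apply/funext => t /=; rewrite of_tupleG.
Qed.

Lemma resample (F : (I -> R) -> R) (i : I) :
  coord_measurable F -> (forall h, 0 <= F h) ->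
  (\int[P]_t (F (g^~ t))%:E =
   \int[P]_t \int[gaussian]_x (F (upd (g^~ t) i x))%:E)%E.
Proof.
move=> mF F0.
have mEF : measurable_fun [set: Y] (fun y : Y => (F (of_tuple y))%:E).
  exact/measurable_EFinP.
have mFU : measurable_fun [set: measurableTypeR R * Y]
      (fun xy => (F (of_tuple (mU i xy)))%:E).
  exact: measurableT_comp mEF (measurable_U i).
transitivity (\int[distribution P mG]_y (F (of_tuple y))%:E)%E.
  rewrite ge0_integral_distribution//; last by move=> y; rewrite lee_fin.
  by apply: eq_integral => t _ /=; rewrite of_tupleG.
rewrite (@eq_measure_integral _ _ _ _
  (distribution (gaussian \x distribution P mG)%E (mU i))); last first.
  by move=> A mA _; exact: law_resampled.
rewrite ge0_integral_distribution//; last by move=> y; rewrite lee_fin.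
rewrite fubini_tonelli2//; last by move=> y; rewrite lee_fin.
rewrite ge0_integral_distribution.
- apply: eq_integral => t _ /=.
  by apply: eq_integral => x _ /=; rewrite of_tupleU /= of_tupleG.
- by apply: measurable_fun_fubini_tonelli_G => // y; rewrite lee_fin.
- by move=> y; apply: integral_ge0 => x _; rewrite lee_fin.
Qed.

(** This plays the role of conditioning on all coordinates but [i]: a bound on the one-dimensional
    integral over coordinate [i], the others being frozen, becomes a bound on the expectation. *)
Lemma resample_le (F F' : (I -> R) -> R) (i : I) :
  coord_measurable F -> coord_measurable F' -> (forall h, 0 <= F h) ->
  (forall h, \int[gaussian]_x (F (upd h i x))%:E <= (F' h)%:E)%E ->
  (\int[P]_t (F (g^~ t))%:E <= \int[P]_t (F' (g^~ t))%:E)%E.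
Proof.
move=> mF mF' F0 FF'; rewrite (resample i)//.
have ge0_int h : (0 <= \int[gaussian]_x (F (upd h i x))%:E)%E.
  by apply: integral_ge0 => x _; rewrite lee_fin.
apply: ge0_le_integral => //.
- have mFU : measurable_fun [set: measurableTypeR R * Y]
      (fun xy => (F (of_tuple (mU i xy)))%:E).
    apply: (measurableT_comp (f := fun y : Y => (F (of_tuple y))%:E)).
      exact/measurable_EFinP.
    exact: measurable_U.
  rewrite (_ : (fun _ => _) = fubini_G gaussian (fun xy => (F (of_tuple (mU i xy)))%:E) \o G).
    apply: measurableT_comp => //; apply: measurable_fun_fubini_tonelli_G => //.
    by move=> y; rewrite lee_fin.
  apply/funext => t /=; apply: eq_integral => x _ /=.
  by rewrite of_tupleU /= of_tupleG.
- by apply/measurable_EFinP; exact: coord_measurable_comp.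
Qed.

End Resampling.

(** * Gaussian integrals *)

Section GaussianIntegrals.
Context {R : realType}.
Local Notation mu := (@lebesgue_measure R).
Local Notation gaussian := (normal_prob 0 1 : probability (measurableTypeR R) R).
Local Notation pdf := (@normal_pdf R 0 1).

Import HBNNSimple.

Let integral_gaussian_nnsfun (f : {nnsfun measurableTypeR R >-> R}) :
  (\int[gaussian]_x (f x)%:E = \int[mu]_x ((f x)%:E * (pdf x)%:E))%E.
Proof.
have mpdf : measurable_fun [set: R] (EFin \o pdf).
  by apply/measurable_EFinP; exact: measurable_normal_pdf.
under [LHS]eq_integral do rewrite fimfunE -fsumEFin//.
rewrite [LHS]ge0_integral_fsum//; last 2 first.
  - by move=> r; exact/measurable_EFinP/measurableT_comp.
  - by move=> n x _; rewrite EFinM nnfun_muleindic_ge0.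
under [RHS]eq_integral.
  move=> x xD; rewrite fimfunE -fsumEFin// muleC ge0_mule_fsumr; last first.
    by move=> r; rewrite EFinM nnfun_muleindic_ge0.
  over.
rewrite [RHS]ge0_integral_fsum//; last 2 first.
  - move=> r; apply: emeasurable_funM => //.
    by apply/measurable_EFinP; do 2 apply/measurableT_comp => //.
  - move=> n x _; rewrite EFinM mule_ge0//; last by rewrite nnfun_muleindic_ge0.
    by rewrite lee_fin normal_pdf_ge0.
apply: eq_fsbigr => r _; rewrite integralZl_indic_nnsfun//= integral_indic//=.
rewrite setIT /normal_prob.
have [r0|r0] := ltP r 0.
  rewrite preimage_nnfun0//= integral_set0 mule0 integral0_eq// => x _.
  by rewrite indic0 mulr0 mule0.
rewrite -ge0_integralZl//; last 2 first.
  by apply: measurable_funTS.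
  by move=> x _; rewrite lee_fin normal_pdf_ge0.
rewrite [LHS]integral_mkcond/=; apply: eq_integral => x _.
rewrite patchE indicE; case: ifPn => _; last by rewrite mulr0 mule0.
by rewrite mulr1 muleC.
Qed.

(** Passage from the Gaussian law to its density, by monotone convergence from simple functions. *)
Lemma integral_gaussian (f : R -> \bar R) :
  measurable_fun setT f -> (forall x, 0 <= f x)%E ->
  (\int[gaussian]_x f x = \int[mu]_x (f x * (pdf x)%:E))%E.
Proof.
move=> mf f0.
have mpdf : measurable_fun [set: R] (EFin \o pdf).
  by apply/measurable_EFinP; exact: measurable_normal_pdf.
pose f_ := nnsfun_approx (@measurableT _ (measurableTypeR R)) (mf : measurable_fun [set: measurableTypeR R] f).
have mf_ n : measurable_fun [set: measurableTypeR R] (fun x => (f_ n x)%:E) by exact/measurable_EFinP.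
have mf_pdf n : measurable_fun [set: measurableTypeR R] (fun x => ((f_ n x)%:E * (pdf x)%:E)%E).
  exact: emeasurable_funM.
have nd_ (x : R) (n m : nat) : (n <= m)%N -> f_ n x <= f_ m x.
  move=> nm; have /lefP := nd_nnsfun_approx (@measurableT _ (measurableTypeR R)) (mf : measurable_fun [set: measurableTypeR R] f) nm; exact.
transitivity (lim (\int[gaussian]_x (f_ n x)%:E @[n --> \oo])%E).
  rewrite -monotone_convergence//=.
  - apply: eq_integral => ? /[!inE] xD; apply/esym/cvg_lim => //=.
    exact: cvg_nnsfun_approx.
  - by move=> n ? _; rewrite lee_fin.
  - by move=> ? _ ? ? mn; rewrite lee_fin; exact: nd_.
rewrite [X in _ = X](_ : _ = lim
    (\int[mu]_x ((f_ n x)%:E * (pdf x)%:E) @[n --> \oo])%E); last first.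
  rewrite -monotone_convergence//=.
  - apply: eq_integral => x /[!inE] xD; apply/esym/cvg_lim => //.
    by apply: cvgeZr => //; exact: cvg_nnsfun_approx.
  - by move=> n x _; rewrite mule_ge0// lee_fin ?normal_pdf_ge0.
  - move=> x _ n m nm; rewrite lee_wpmul2r ?lee_fin ?normal_pdf_ge0//.
    exact: nd_.
by apply: congr_lim; apply/funext => n /=; exact: integral_gaussian_nnsfun.
Qed.

Let integral_oneDsqrV : (\int[mu]_x ((oneDsqr x)^-1)%:E = pi%:E)%E.
Proof.
rewrite ge0_symfun_integralT; first last.
- by move=> x /=; rewrite /oneDsqr sqrrN.
- exact: continuous_oneDsqrV.
- by move=> x; rewrite invr_ge0 (le_trans ler01)// oneDsqr_ge1.
rewrite -set_itvcy integral0y_oneDsqr -EFinM; congr EFin.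
by rewrite mulrC divfK// pnatr_eq0.
Qed.

Let peak1 : normal_peak (1 : R) <= 1.
Proof.
rewrite /normal_peak expr1n mul1r invf_le1.
  rewrite -sqrtr1 ler_wsqrtr//; have := @pi_ge2 R; lra.
by rewrite sqrtr_gt0 mulrn_wgt0// pi_gt0.
Qed.

Let pdf_le1 x : pdf x <= 1.
Proof.
exact: le_trans (normal_pdf_ub _ _ (oner_neq0 _)) peak1.
Qed.

(** The Gaussian density is at most 1, so the integral is at most the total mass of a Cauchy kernel.
    That mass depends neither on the centre nor on the width [s]; this uniformity is the source of
    the Wegner estimate. *)
Lemma gaussian_cauchy_le (s r v : R) : 0 < s -> 0 < v ->
  (\int[gaussian]_x (s / ((v * x + r) ^+ 2 + s ^+ 2))%:E <= (pi / v)%:E)%E.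
Proof.
move=> s0 v0.
have den0 x : 0 < (v * x + r) ^+ 2 + s ^+ 2.
  by rewrite ltr_wpDl ?sqr_ge0// exprn_gt0.
have mf : measurable_fun [set: R] (fun x : R => s / ((v * x + r) ^+ 2 + s ^+ 2)).
  apply: continuous_measurable_fun => x.
  apply: cvgM; first exact: cvg_cst.
  apply: cvgV; first by rewrite gt_eqF.
  apply: cvgD; last exact: cvg_cst.
  apply: (@cvg_comp _ _ _ (fun x => v * x + r) (fun y => y ^+ 2)).
    apply: cvgD; last exact: cvg_cst.
    by apply: cvgM; [exact: cvg_cst|exact: cvg_id].
  exact: exprn_continuous.
have f0 x : 0 <= s / ((v * x + r) ^+ 2 + s ^+ 2) by rewrite divr_ge0// ltW.
rewrite integral_gaussian; last 2 first.
- exact/measurable_EFinP.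
- by move=> x; rewrite lee_fin.
(* The substitution u = (v x + r) / s turns the kernel into 1 / (1 + u^2). *)
pose F (x : R) := (x + r / v) * (v / s).
have dF (x : R) : is_derive x 1 F (v / s).
  by apply: is_derive_eq; rewrite scaler0 add0r addr0 /GRing.scale /= mulr1.
have F'E : F^`()%classic = cst (v / s).
  by apply/funext => x; rewrite derive1E; exact: derive_val.
pose G := (fun x : R => (oneDsqr x)^-1).
have cF : continuous F.
  by move=> x; apply: differentiable_continuous; apply/derivable1_diffP; apply: ex_derive.
have cG : continuous G := @continuous_oneDsqrV R.
have G0 x : 0 <= G x by rewrite invr_ge0 (le_trans ler01)// oneDsqr_ge1.
have mGF : measurable_fun [set: R] (fun x => (((G \o F) * F^`()%classic) x)%:E).
  apply/measurable_EFinP; rewrite F'E; apply: measurable_funM => //.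
  apply: continuous_measurable_fun => x.
  by apply: continuous_comp; [exact: cF|exact: cG].
have mvGF : measurable_fun [set: R]
    (fun x => ((v^-1)%:E * (((G \o F) * F^`()%classic) x)%:E)%E).
  exact: emeasurable_funM.
have mfpdf : measurable_fun [set: R]
    (fun x : R => ((s / ((v * x + r) ^+ 2 + s ^+ 2))%:E * (pdf x)%:E)%E).
  apply: emeasurable_funM; apply/measurable_EFinP => //.
  exact: measurable_normal_pdf.
apply: (@le_trans _ _ (\int[mu]_x ((v^-1)%:E * (((G \o F) * F^`()%classic) x)%:E))%E).
  apply: ge0_le_integral => //.
  - by move=> x _; rewrite mule_ge0// lee_fin ?normal_pdf_ge0.
  - move=> x _; rewrite F'E -!EFinM lee_fin.
    apply: (@le_trans _ _ (s / ((v * x + r) ^+ 2 + s ^+ 2))).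
      by rewrite ler_piMr.
    rewrite le_eqVlt; apply/orP; left; apply/eqP.
    rewrite [X in _ = _ * X](_ : _ = G (F x) * (v / s)) // /G /oneDsqr /F.
    have := den0 x; have -> : (x + r / v) * (v / s) = (v * x + r) / s.
      by field; rewrite !gt_eqF.
    set q := (v * x + r) => q0.
    have -> : 1 + (q / s) ^+ 2 = (q ^+ 2 + s ^+ 2) / s ^+ 2.
      by field; rewrite gt_eqF.
    by field; rewrite !gt_eqF.
rewrite ge0_integralZl//; last first.
- by rewrite lee_fin invr_ge0 ltW.
- by move=> x _; rewrite F'E lee_fin mulr_ge0// ?G0// /cst divr_ge0// ltW.
rewrite -increasing_ge0_integration_by_substitutionT//.
- by rewrite integral_oneDsqrV -EFinM mulrC.
- by move=> x y xy; rewrite /F ltr_pM2r ?divr_gt0// ltrD2r.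
- by rewrite F'E => ?; exact: cvg_cst.
- by rewrite F'E; exact: is_cvg_cst.
- by rewrite F'E; exact: is_cvg_cst.
- by apply/gt0_cvgMlNy; [rewrite divr_gt0|exact: cvg_addrr_Ny].
- by apply/gt0_cvgMly; [rewrite divr_gt0|exact: cvg_addrr].
Qed.

Let decay_aux (p e y : R) : 0 <= p -> p <= 1 -> 0 <= y -> 1 + y <= e ->
  4 * y * (p / (e * e)) * (1 + 4 * y) <= 16.
Proof.
move=> p0 p1 y0 ye; have e0 : 0 < e by rewrite (lt_le_trans _ ye)// ltr_pwDl.
have -> : 4 * y * (p / (e * e)) * (1 + 4 * y) = p * (4 * y * (1 + 4 * y)) / (e * e).
  by field; rewrite gt_eqF.
rewrite ler_pdivrMr ?mulr_gt0//.
apply: (@le_trans _ _ (4 * y * (1 + 4 * y))).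
  by rewrite ler_piMl// !mulr_ge0// addr_ge0// mulr_ge0.
apply: (@le_trans _ _ (16 * ((1 + y) * (1 + y)))); first by nra.
by rewrite ler_wpM2l// ler_pM// addr_ge0.
Qed.

(** With y = x^2/4 the exponential factor is exp(-y) squared. Using exp y >= 1 + y for each of the
    two factors gives enough decay to dominate by the integrable kernel 1 / (1 + x^2). *)
Let pdf_decay (x : R) : x ^+ 2 * pdf x <= 16 / oneDsqr x.
Proof.
rewrite ler_pdivlMr; last by rewrite (lt_le_trans ltr01)// oneDsqr_ge1.
rewrite normal_pdfE ?oner_neq0// /normal_fun subr0 expr1n.
pose y := x ^+ 2 / 4.
have -> : - x ^+ 2 / (1 *+ 2) = - (y + y) by rewrite /y; field.
have xy : x ^+ 2 = 4 * y by rewrite /y; field.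
rewrite expRN expRD /oneDsqr xy; apply: decay_aux => //.
- exact: normal_peak_ge0.
- by rewrite divr_ge0// sqr_ge0.
- exact: expR_ge1Dx.
Qed.

Let mpdf : measurable_fun [set: R] (fun x => (pdf x)%:E).
Proof. by apply/measurable_EFinP; exact: measurable_normal_pdf. Qed.

Let moDs : measurable_fun [set: R] (fun x : R => ((oneDsqr x)^-1)%:E).
Proof.
by apply/measurable_EFinP; exact: continuous_measurable_fun continuous_oneDsqrV.
Qed.

Let oDsV_ge0 (x : R) : 0 <= (oneDsqr x)^-1.
Proof. by rewrite invr_ge0 (le_trans ler01)// oneDsqr_ge1. Qed.

Let integral_majorant (A B : R) : 0 <= A -> 0 <= B ->
  (\int[mu]_x (A%:E * (pdf x)%:E + B%:E * ((oneDsqr x)^-1)%:E) =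
   (A + B * pi)%:E)%E.
Proof.
move=> A0 B0; rewrite ge0_integralD.
- have -> : (\int[mu]_x (A%:E * (pdf x)%:E) = A%:E)%E.
    rewrite ge0_integralZl ?integral_normal_pdf ?mule1 ?lee_fin// => x _.
    by rewrite lee_fin normal_pdf_ge0.
  have -> : (\int[mu]_x (B%:E * ((oneDsqr x)^-1)%:E) = (B * pi)%:E)%E.
    by rewrite ge0_integralZl ?integral_oneDsqrV ?lee_fin// => x _; rewrite lee_fin.
  by rewrite -EFinD.
- exact: measurableT.
- by move=> x _; apply: mule_ge0; rewrite lee_fin// normal_pdf_ge0.
- exact: emeasurable_funM.
- by move=> x _; apply: mule_ge0; rewrite lee_fin.
- exact: emeasurable_funM.
Qed.

(** Averaging the integrand with its reflection under x -> -x cancels the linear term while all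
    integrands stay nonnegative. The constant 16 pi is a crude bound for the second moment, obtained
    from [pdf_decay]. *)
Lemma gaussian_quadratic_le (a b k : R) : 0 <= a -> 0 <= k ->
  (forall x, 0 <= a + b * x + k * x ^+ 2) ->
  (\int[gaussian]_x (a + b * x + k * x ^+ 2)%:E <= (a + 16 * pi * k)%:E)%E.
Proof.
move=> a0 k0; set f := (fun x : R => a + b * x + k * x ^+ 2) => f0.
have cf : continuous f.
  move=> x; apply: cvgD; last first.
    apply: cvgM; first exact: cvg_cst.
    exact: exprn_continuous.
  apply: cvgD; first exact: cvg_cst.
  by apply: cvgM; [exact: cvg_cst|exact: cvg_id].
have mf : measurable_fun [set: R] f := continuous_measurable_fun cf.
rewrite integral_gaussian; last 2 first.
- exact/measurable_EFinP.
- by move=> x; rewrite lee_fin.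
have pdfN x : pdf (- x) = pdf x.
  by rewrite !normal_pdfE ?oner_eq0// /normal_fun !subr0 sqrrN.
pose h (x : R) : \bar R := ((f x)%:E * (pdf x)%:E)%E.
have mh : measurable_fun [set: R] h.
  by apply: emeasurable_funM => //; apply/measurable_EFinP.
have h0 x : (0 <= h x)%E by apply: mule_ge0; rewrite lee_fin ?normal_pdf_ge0//; exact: f0.
have mhN : measurable_fun [set: R] (h \o -%R).
  by apply: measurableT_comp => //; exact: oppr_measurable.
have hN : (\int[mu]_x h x = \int[mu]_x h (- x)%R)%E.
  transitivity (\int[pushforward mu (-%R : _ -> measurableTypeR R)]_x h x)%E.
    by apply: eq_measure_integral => A mA _; exact/esym/lebesgue_measureN.
  by rewrite ge0_integral_pushforward.
have h2 : (\int[mu]_x h x + \int[mu]_x h x <= ((a + 16 * pi * k) *+ 2)%:E)%E.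
  rewrite {2}hN -ge0_integralD; [|exact: measurableT|by move=> x _|by []|by move=> x _|by []].
  have -> : (a + 16 * pi * k) *+ 2 = a *+ 2 + 32 * k * pi by ring.
  rewrite -integral_majorant; [|by rewrite mulrn_wge0|by rewrite mulr_ge0].
  apply: ge0_le_integral.
  - exact: measurableT.
  - by move=> x _; exact: adde_ge0.
  - exact: emeasurable_funD.
  - by apply: emeasurable_funD; exact: emeasurable_funM.
  - move=> x _; rewrite /h pdfN /f sqrrN -!EFinM -!EFinD lee_fin.
    have kx : k * (x ^+ 2 * pdf x) <= k * (16 / oneDsqr x) by rewrite ler_wpM2l.
    have -> : (a + b * x + k * x ^+ 2) * pdf x + (a + b * - x + k * x ^+ 2) * pdf x =
      a *+ 2 * pdf x + 2 * (k * (x ^+ 2 * pdf x)) by ring.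
    by rewrite lerD2l (_ : 32 * k / _ = 2 * (k * (16 / oneDsqr x))) ?ler_wpM2l//; ring.
have : (0 <= \int[mu]_x h x)%E by apply: integral_ge0 => x _.
move: h2; rewrite -/h; case: (\int[mu]_x h x)%E => //= y.
by rewrite -EFinD !lee_fin; lra.
Qed.

End GaussianIntegrals.

(** * Spectral theorem for real symmetric matrices *)

Section SpectralTheorem.
Context {R : rcfType}.

Let dotself_eq0 n (x : 'rV[R]_n) : ((x *m x^T) 0 0 == 0) = (x == 0).
Proof.
rewrite mxE psumr_eq0 => [|j _]; last by rewrite mxE -expr2 sqr_ge0.
apply/allP/eqP => [x0|-> j _]; last by rewrite !mxE mul0r eqxx.
apply/rowP => j; rewrite mxE; apply/eqP; have := x0 j (mem_index_enum j).
by rewrite mxE mulf_eq0 orbb.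
Qed.

Let dotself_ge0 n (x : 'rV[R]_n) : 0 <= (x *m x^T) 0 0.
Proof. by rewrite mxE sumr_ge0// => j _; rewrite mxE -expr2 sqr_ge0. Qed.

(* Splitting a complex eigenvector equation into real and imaginary parts,
   symmetry of A forces the imaginary part of the eigenvalue to vanish. *)
Lemma symmetric_eigenvector n (A : 'M[R]_n.+1) : A^T = A ->
  exists (v : 'rV[R]_n.+1) (l : R), v *m v^T = 1%:M /\ v *m A = l *: v.
Proof.
move=> symA; pose AC := map_mx (real_complex R) A.
have [[a b] aA] := eigenvalue_closed AC (ltn0Sn n).
have [v vA v0] := eigenvalueP aA.
pose x : 'rV[R]_n.+1 := \row_j complex.Re (v 0 j).
pose y : 'rV[R]_n.+1 := \row_j complex.Im (v 0 j).
have vAE j : (v *m AC) 0 j = Complex ((x *m A) 0 j) ((y *m A) 0 j).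
  rewrite !mxE; apply/eqP; rewrite eq_complex /=; apply/andP; split; apply/eqP.
    by rewrite raddf_sum; apply: eq_bigr => i _; rewrite !mxE; case: (v 0 i) => p q /=; ring.
  by rewrite raddf_sum; apply: eq_bigr => i _; rewrite !mxE; case: (v 0 i) => p q /=; ring.
have xyA : x *m A = a *: x - b *: y /\ y *m A = b *: x + a *: y.
  split; apply/rowP => j; have /matrixP/(_ 0 j) := vA; rewrite vAE !mxE;
    by case: (v 0 j) => p q /= [] ? ?; lra.
have [xA yA] := xyA.
have b0 : b = 0.
  have : (x *m A) *m y^T = ((y *m A) *m x^T)^T.
    by rewrite !trmx_mul trmxK symA mulmxA.
  rewrite xA yA mulmxBl mulmxDl linearD /= -!scalemxAl !linearZ /= !trmx_mul !trmxK.
  move/matrixP/(_ 0 0); rewrite !mxE.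
  have := dotself_ge0 x; have := dotself_ge0 y.
  have := dotself_eq0 x; have := dotself_eq0 y.
  rewrite !mxE.
  set p := \sum_j x _ _ * _; set q := \sum_j y _ _ * _.
  move=> q0 p0 q_ge0 p_ge0 e.
  have {}e : b * (p + q) = 0 by lra.
  have [//|bN0] := eqVneq b 0; exfalso.
  move/eqP: e; rewrite mulf_eq0 (negbTE bN0) /= addr_eq0 => pq.
  have {}q0 : y = 0 by apply/eqP; rewrite -q0; apply/eqP; lra.
  have {}p0 : x = 0 by apply/eqP; rewrite -p0; apply/eqP; lra.
  move/negP: v0; apply; apply/eqP/rowP => j; rewrite mxE; apply/eqP.
  have /rowP/(_ j) := q0; have /rowP/(_ j) := p0; rewrite !mxE => xj yj.
  by rewrite eq_complex xj yj !eqxx.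
have [z z0 zA] : exists2 z : 'rV[R]_n.+1, z != 0 & z *m A = a *: z.
  have [x0|xN0] := eqVneq x 0; last by exists x; rewrite // xA b0 scale0r subr0.
  exists y; last by rewrite yA b0 scale0r add0r.
  apply: contra v0 => /eqP y0; apply/eqP/rowP => j; rewrite mxE; apply/eqP.
  have /rowP/(_ j) := x0; have /rowP/(_ j) := y0; rewrite !mxE => xj yj.
  by rewrite eq_complex xj yj !eqxx.
have zz : 0 < (z *m z^T) 0 0 by rewrite lt_def dotself_eq0 z0 dotself_ge0.
exists ((Num.sqrt ((z *m z^T) 0 0))^-1 *: z), a; split; last first.
  by rewrite -scalemxAl zA !scalerA mulrC.
set k := (Num.sqrt _)^-1.
apply/matrixP => i j; rewrite !ord1 [RHS]mxE eqxx.
have -> : ((k *: z) *m (k *: z)^T) 0 0 = k * k * (z *m z^T) 0 0.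
  by rewrite linearZ /= -scalemxAl -scalemxAr scalerA mxE.
by rewrite -invfM -expr2 sqr_sqrtr ?ltW// mulVf// gt_eqF.
Qed.

(** Completes a unit vector to an orthogonal matrix: the reflection along [e - v] exchanges the
    first basis vector [e] with [v]. The identity serves when they coincide and there is nothing to
    reflect along. *)
Let householder n (v : 'rV[R]_n.+1) : v *m v^T = 1%:M ->
  exists Q : 'M[R]_n.+1, Q *m Q^T = 1%:M /\ row 0 Q = v.
Proof.
move=> vv; pose e : 'rV[R]_n.+1 := delta_mx 0 0.
have rowE (M : 'M[R]_n.+1) : row 0 M = e *m M by rewrite rowE.
have [ve|vNe] := eqVneq v e.
  by exists 1%:M; rewrite trmx1 mulmx1 ve rowE mulmx1.
pose w := e - v; pose q := (w *m w^T) 0 0.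
have q0 : q != 0 by rewrite dotself_eq0 subr_eq0 eq_sym.
have wwE : w *m w^T = q%:M by apply/matrixP => i j; rewrite !ord1 [RHS]mxE eqxx.
have wTw : (w^T *m w) *m (w^T *m w) = q *: (w^T *m w).
  by rewrite mulmxA -(mulmxA w^T) wwE mul_mx_scalar -scalemxAl.
pose Q := 1%:M - (2 / q) *: (w^T *m w).
have QT : Q^T = Q by rewrite linearB /= trmx1 linearZ /= trmx_mul trmxK.
exists Q; split.
  rewrite QT /Q; move: (w^T *m w) wTw => W WW.
  rewrite mulmxBl mul1mx mulmxBr mulmx1 -!scalemxAl -!scalemxAr WW !scalerA.
  have -> : 2 / q * (2 / q) * q = 2 / q + 2 / q by field.
  by rewrite scalerDl opprB addrK subrK.
have ew : e *m w^T = (q / 2)%:M.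
  apply/matrixP => i j; rewrite !ord1 [RHS]mxE eqxx.
  have ee : e *m e^T = 1%:M.
    by rewrite trmx_delta mul_delta_mx; apply/matrixP => i' j'; rewrite !ord1 !mxE eqxx.
  have ev : e *m v^T = v *m e^T.
    by rewrite -[RHS]trmxK trmx_mul trmxK; apply/matrixP=> i' j'; rewrite !ord1 [RHS]mxE.
  have -> : q = 2 * (e *m w^T) 0 0.
    rewrite /q /w linearB /= mulmxBl !mulmxBr ee vv ev !mxE eqxx /=; ring.
  by rewrite mulr1n; field.
rewrite rowE mulmxBr mulmx1 -scalemxAr mulmxA ew mul_scalar_mx scalerA.
by rewrite (_ : 2 / q * (q / 2) = 1) ?scale1r /w ?subKr//; field.
Qed.

Let block_of_row0 n (M : 'M[R]_(1 + n)) (l : R) : M^T = M ->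
  row 0 M = l *: delta_mx 0 0 -> M = block_mx l%:M 0 0 (drsubmx M).
Proof.
move=> symM M0; rewrite -[LHS]submxK; congr block_mx.
- apply/matrixP => i j; rewrite !ord1 !mxE eqxx.
  have /rowP/(_ 0) := M0; rewrite !mxE !eqxx mulr1 mulr1n => <-.
  by congr (M _ _); apply/val_inj.
- apply/matrixP => i j; rewrite !ord1 !mxE.
  have /rowP/(_ (rshift 1 j)) := M0; rewrite !mxE /= mulr0 => <-.
  by congr (M _ _); apply/val_inj.
- apply/matrixP => i j; rewrite !ord1 !mxE -symM mxE.
  have /rowP/(_ (rshift 1 i)) := M0; rewrite !mxE /= mulr0 => <-.
  by congr (M _ _); apply/val_inj.
Qed.

(** Deflation: rotate a unit eigenvector onto the first basis vector; by symmetry the rotated matrix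
    splits into a 1 x 1 block and a smaller symmetric one. *)
Lemma symmetric_spectral n (A : 'M[R]_n) : A^T = A ->
  exists (O : 'M[R]_n) (l : 'rV[R]_n),
    O^T *m O = 1%:M /\ A = O *m diag_mx l *m O^T.
Proof.
elim: n A => [|n IH] A symA.
  by exists 1%:M, 0; split; rewrite ?trmx1 ?mulmx1//; apply/matrixP => -[].
have [v [l [vv vA]]] := symmetric_eigenvector symA.
have [Q [QQ Qv]] := householder vv.
pose M : 'M[R]_(1 + n) := Q *m A *m Q^T.
have symM : M^T = M by rewrite !trmx_mul trmxK symA mulmxA.
have M0 : row 0 M = l *: delta_mx 0 0.
  rewrite /M !row_mul Qv vA -scalemxAl; congr (_ *: _).
  by rewrite -Qv -row_mul QQ row1.
have ME := block_of_row0 symM M0.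
have [|O [d [OO ME']]] := IH (drsubmx M); first by rewrite trmx_drsub symM.
pose O1 : 'M[R]_(1 + n) := block_mx 1%:M 0 0 O.
have O1O1 : O1^T *m O1 = 1%:M.
  rewrite /O1 tr_block_mx mulmx_block !trmx1 !trmx0 !mul0mx !mulmx0 !mulmx1 OO !addr0 !add0r.
  by rewrite -scalar_mx_block.
pose D : 'M[R]_(1 + n) := diag_mx (row_mx l%:M d).
have DE : M = O1 *m D *m O1^T.
  have -> : D = block_mx l%:M 0 0 (diag_mx d).
    rewrite /D diag_mx_row; congr block_mx.
    by apply/matrixP => i j; rewrite !ord1 !mxE eqxx.
  rewrite ME {1}ME' /O1 tr_block_mx !trmx1 !trmx0 !mulmx_block.
  by rewrite !(mul0mx, mulmx0, mulmx1, mul1mx, addr0, add0r).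
exists (Q^T *m O1), (row_mx l%:M d); split.
  by rewrite trmx_mul trmxK mulmxA -(mulmxA _ Q) QQ mulmx1.
have -> : A = Q^T *m M *m Q.
  by rewrite /M !mulmxA (mulmx1C QQ) mul1mx -mulmxA (mulmx1C QQ) mulmx1.
by rewrite DE trmx_mul trmxK !mulmxA.
Qed.

End SpectralTheorem.

(** * Squared resolvents and the Wegner estimate *)

Section SquaredResolvent.
Context {R : realType} {N : nat}.
Implicit Types (A O : 'M[R]_N) (l : 'rV[R]_N) (E eta : R).

Definition shifted_square A E eta : 'M[R]_N :=
  (A - E%:M) *m (A - E%:M) + (eta ^+ 2)%:M.

(* |A - E - i eta|^-2 for symmetric A *)
Definition sqres A E eta : 'M[R]_N := invmx (shifted_square A E eta).

Definition lorentz l E eta : 'rV[R]_N := \row_j ((l 0 j - E) ^+ 2 + eta ^+ 2)^-1.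

Lemma lorentz_den_gt0 (a eta : R) : eta != 0 -> 0 < a ^+ 2 + eta ^+ 2.
Proof. by move=> e0; rewrite ltr_wpDl ?sqr_ge0// exprn_even_gt0. Qed.

Lemma orthoC O : O^T *m O = 1%:M -> O *m O^T = 1%:M.
Proof. exact: mulmx1C. Qed.

Lemma shifted_square_spectral A O l E eta : O^T *m O = 1%:M ->
  A = O *m diag_mx l *m O^T ->
  shifted_square A E eta =
    O *m diag_mx (\row_j ((l 0 j - E) ^+ 2 + eta ^+ 2)) *m O^T.
Proof.
move=> OO ->; have OO' := orthoC OO.
have scalE (a : R) : a%:M = O *m a%:M *m O^T.
  by rewrite mul_mx_scalar -scalemxAl OO' scalemx1.
rewrite /shifted_square {1 2}(scalE E) -mulmxBl -mulmxBr.
rewrite !mulmxA -(mulmxA _ O^T O) OO mulmx1 -(mulmxA O (diag_mx l - E%:M)).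
rewrite (scalE (eta ^+ 2)) -mulmxDl -mulmxDr; congr (_ *m _ *m _).
apply/matrixP => i j; rewrite !mxE (bigD1 i)//= big1 => [|k ki]; rewrite !mxE.
  rewrite eqxx !mulr1n addr0; case: (eqVneq i j) => [->|_].
    by rewrite !mulr1n expr2.
  by rewrite !mulr0n subr0 mulr0 addr0.
by rewrite eq_sym (negbTE ki) !mulr0n subrr mul0r.
Qed.

Lemma sqres_spectral A O l E eta : O^T *m O = 1%:M -> eta != 0 ->
  A = O *m diag_mx l *m O^T ->
  shifted_square A E eta \in unitmx /\
  sqres A E eta = O *m diag_mx (lorentz l E eta) *m O^T.
Proof.
move=> OO e0 AE; have OO' := orthoC OO.
have inv1 : shifted_square A E eta *m (O *m diag_mx (lorentz l E eta) *m O^T) = 1%:M.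
  rewrite (shifted_square_spectral E eta OO AE).
  rewrite !mulmxA -(mulmxA _ O^T O) OO mulmx1 -(mulmxA O).
  rewrite [X in O *m X](_ : _ = 1%:M) ?mulmx1//.
  apply/matrixP => i j; rewrite !mxE (bigD1 i)//= big1 => [|k ki]; rewrite !mxE.
    rewrite eqxx mulr1n addr0; case: eqVneq => [->|_]; last by rewrite !mulr0n mulr0.
    by rewrite !mulr1n mulfV// gt_eqF// lorentz_den_gt0.
  by rewrite eq_sym (negbTE ki) mulr0n mul0r.
have [u _] := mulmx1_unit inv1; split=> //.
by rewrite -[RHS]mul1mx -(mulVmx u) -[RHS]mulmxA inv1 mulmx1.
Qed.

Lemma spectral_entry O (d : 'rV[R]_N) x y :
  (O *m diag_mx d *m O^T) x y = \sum_j O x j * O y j * d 0 j.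
Proof.
rewrite mxE; apply: eq_bigr => j _; rewrite mul_mx_diag !mxE; ring.
Qed.

Lemma sqres_diagE A O l E eta x : O^T *m O = 1%:M -> eta != 0 ->
  A = O *m diag_mx l *m O^T ->
  sqres A E eta x x = \sum_j O x j ^+ 2 / ((l 0 j - E) ^+ 2 + eta ^+ 2).
Proof.
move=> OO e0 AE; rewrite (sqres_spectral E OO e0 AE).2 spectral_entry.
by apply: eq_bigr => j _; rewrite mxE -expr2.
Qed.

Lemma shifted_square_unit A E eta : A^T = A -> eta != 0 ->
  shifted_square A E eta \in unitmx.
Proof.
by move=> /symmetric_spectral[V [l [OO AE]]] e0; have [] := sqres_spectral E OO e0 AE.
Qed.

Lemma ortho_row_norm O x : O^T *m O = 1%:M -> \sum_j O x j ^+ 2 = 1.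
Proof.
move=> /orthoC /matrixP/(_ x x); rewrite !mxE eqxx mulr1n => <-.
by apply: eq_bigr => j _; rewrite mxE expr2.
Qed.

Lemma sqres_diag_gt0 A E eta x : A^T = A -> eta != 0 -> 0 < sqres A E eta x x.
Proof.
move=> /symmetric_spectral[V [l [OO AE]]] e0; rewrite (sqres_diagE _ _ OO e0 AE).
have term_ge0 j : 0 <= V x j ^+ 2 / ((l 0 j - E) ^+ 2 + eta ^+ 2).
  by rewrite divr_ge0 ?sqr_ge0// ltW// lorentz_den_gt0.
rewrite lt_def sumr_ge0// andbT psumr_eq0//; apply/negP => /allP h.
have V0 j : V x j ^+ 2 = 0.
  have := h j (mem_index_enum j); rewrite /= mulf_eq0 invr_eq0.
  by rewrite [X in _ || X]gt_eqF ?lorentz_den_gt0// orbF => /eqP.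
have := ortho_row_norm x OO; rewrite big1 => [/esym/eqP|j _]; last exact: V0.
by rewrite oner_eq0.
Qed.

Lemma sqres_sym A E eta : A^T = A -> (sqres A E eta)^T = sqres A E eta.
Proof.
move=> symA; rewrite /sqres trmx_inv; congr invmx.
by rewrite linearD /= trmx_mul tr_scalar_mx linearB /= symA tr_scalar_mx.
Qed.

(* The resolvent vector (A - E - i eta)^-1 e_z = p + i q. *)
Lemma resolvent_vector A E eta z : A^T = A -> eta != 0 ->
  let q := eta *: col z (sqres A E eta) in
  let p := (A - E%:M) *m col z (sqres A E eta) in
  (A - E%:M) *m p + eta *: q = delta_mx z 0 /\ (A - E%:M) *m q = eta *: p.
Proof.
move=> symA e0 q p; split; last by rewrite /q /p -scalemxAr.
rewrite /p /q mulmxA scalerA -expr2 -mul_scalar_mx -mulmxDl -/(shifted_square A E eta).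
by rewrite !colE mulmxA mulmxV ?mul1mx// shifted_square_unit.
Qed.

(** The two hypotheses are the real and imaginary parts of (A - E - i eta)(p + i q) = e_z.
    Eliminating [p] shows that the shifted square sends [q] to eta e_z. *)
Lemma resolvent_vector_unique A E eta z (p q : 'cV[R]_N) : A^T = A -> eta != 0 ->
  (A - E%:M) *m p + eta *: q = delta_mx z 0 -> (A - E%:M) *m q = eta *: p ->
  q = eta *: col z (sqres A E eta).
Proof.
move=> symA e0 e1 e2; have u := shifted_square_unit E symA e0.
rewrite colE scalemxAr -[q]mul1mx -(mulVmx u) -mulmxA; congr (_ *m _).
rewrite mulmxDl mul_scalar_mx -mulmxA e2 -scalemxAr -e1 scalerDr scalerA.
by rewrite expr2.
Qed.

(** With G = f + i g the diagonal resolvent entry, the perturbed entry is G / (1 + x G), with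
    imaginary part g / |1 + x G|^2. The perturbed resolvent vector is the old one times the complex
    number a + i b = 1 / (1 + x G), and uniqueness identifies it. *)
Lemma sqres_rank_one A E eta z (x : R) : A^T = A -> eta != 0 ->
  let f := ((A - E%:M) *m sqres A E eta) z z in
  let g := eta * sqres A E eta z z in
  eta * sqres (A + x *: delta_mx z z) E eta z z =
  g / ((1 + x * f) ^+ 2 + (x * g) ^+ 2).
Proof.
move=> symA e0 f g; set B := A + _.
have g0 : g != 0 by rewrite mulf_neq0// gt_eqF// sqres_diag_gt0.
have D0 : (1 + x * f) ^+ 2 + (x * g) ^+ 2 != 0.
  have [->|x0] := eqVneq x 0; first by rewrite !mul0r addr0 expr0n addr0 expr1n oner_eq0.
  by rewrite gt_eqF// lorentz_den_gt0// mulf_neq0.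
have symB : B^T = B by rewrite linearD /= linearZ /= symA trmx_delta.
have [e1 e2] := resolvent_vector E z symA e0.
move: e1 e2; set q := eta *: col _ _; set p := _ *m col z _ => e1 e2.
have pz : p z 0 = f by rewrite /p /f mxE [RHS]mxE; apply: eq_bigr => j _; congr (_ * _); rewrite mxE.
have qz : q z 0 = g by rewrite /q /g 2!mxE.
clearbody p q.
set D := _ + _ in D0 *.
pose a := (1 + x * f) / D; pose b := - (x * g) / D.
pose p' := a *: p - b *: q; pose q' := a *: q + b *: p.
have Bv (v : 'cV[R]_N) : (B - E%:M) *m v = (A - E%:M) *m v + (x * v z 0) *: delta_mx z 0.
  rewrite /B addrAC mulmxDl; congr (_ + _).
  rewrite -scalemxAl -scalerA; congr (_ *: _).
  apply/matrixP => i j; rewrite !ord1 !mxE (bigD1 z)//= !mxE eqxx andbT big1 => [|k kz].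
    by rewrite addr0 mulrC.
  by rewrite !mxE (negbTE kz) andbF mul0r.
have q'E : q' = eta *: col z (sqres B E eta).
  apply: (@resolvent_vector_unique B E eta z p' q') => //.
    rewrite Bv /p' mulmxBr -!scalemxAr /q' scalerDr e2.
    have -> : (a *: p - b *: q) z 0 = a * f - b * g by rewrite !mxE pz qz.
    have -> : (A - E%:M) *m p = delta_mx z 0 - eta *: q by rewrite -e1 addrK.
    transitivity ((a + x * (a * f - b * g)) *: delta_mx z 0 :> 'cV[R]_N).
      by apply/matrixP => i j; rewrite !mxE; ring.
    rewrite [X in X *: _](_ : _ = 1) ?scale1r//.
    by rewrite /a /b /D; field; exact: D0.
  rewrite Bv /q' mulmxDr -!scalemxAr e2.
  have -> : (A - E%:M) *m p = delta_mx z 0 - eta *: q by rewrite -e1 addrK.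
  have -> : (a *: q + b *: p) z 0 = a * g + b * f by rewrite !mxE pz qz.
  apply/matrixP => i j; rewrite !mxE.
  have : b + x * (a * g + b * f) = 0 by rewrite /a /b /D; field; exact: D0.
  by move=> h; set dd := _%:R; have := congr1 (fun t => t * dd) h => /= h'; nra.
have := congr1 (fun M : 'cV[R]_N => M z 0) q'E.
rewrite [RHS]mxE [in RHS]mxE => <-; rewrite !mxE pz qz /a /b /D; by field; exact: D0.
Qed.

End SquaredResolvent.

(** * Measurability of matrix-valued maps *)

Section MeasurableMatrices.
Context {R : realType} {d : measure_display} {T : measurableType d}.

Lemma measurable_inv (f : T -> R) : measurable_fun setT f ->
  measurable_fun setT (fun t => (f t)^-1).
Proof.
move=> mf; apply: (measurableT_comp (f := @GRing.inv R)) => //.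
rewrite -(setUv [set 0 : R]).
apply/measurable_funU => //; first exact: measurableC.
split.
  have cst0 : measurable_fun [set (0 : R)] (fun _ : R => 0 : R) by exact: measurable_cst.
  by apply: eq_measurable_fun cst0 => x; rewrite inE /= => ->; rewrite invr0.
apply: open_continuous_measurable_fun.
  by apply: closed_openC; exact: closed_eq.
by move=> x; rewrite inE /= => /eqP x0; exact: inv_continuous.
Qed.

Lemma measurable_sum_cond (I : finType) (P : pred I) (f : I -> T -> R) :
  (forall i, measurable_fun setT (f i)) ->
  measurable_fun setT (fun t => \sum_(i | P i) f i t).
Proof.
move=> mf; under eq_fun do rewrite big_mkcond; apply: measurable_sum => i.
by case: (P i) => //; exact: measurable_cst.
Qed.

Definition measurable_mx m n (M : T -> 'M[R]_(m, n)) : Prop :=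
  forall i j, measurable_fun setT (fun t => M t i j).

Lemma measurable_det n (M : T -> 'M[R]_n) : measurable_mx M ->
  measurable_fun setT (fun t => \det (M t)).
Proof.
move=> mM; rewrite /determinant; apply: measurable_sum => s.
by apply: measurable_funM => //; apply: measurable_prod => i _; exact: mM.
Qed.

Lemma measurable_mulmx m n p (M : T -> 'M[R]_(m, n)) (M' : T -> 'M[R]_(n, p)) :
  measurable_mx M -> measurable_mx M' -> measurable_mx (fun t => M t *m M' t).
Proof.
move=> mM mM' i j; under eq_fun do rewrite mxE.
by apply: measurable_sum => k; exact: measurable_funM.
Qed.

Lemma measurable_addmx m n (M M' : T -> 'M[R]_(m, n)) :
  measurable_mx M -> measurable_mx M' -> measurable_mx (fun t => M t + M' t).
Proof.
by move=> mM mM' i j; under eq_fun do rewrite mxE; exact: measurable_funD.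
Qed.

Lemma measurable_cstmx m n (M : 'M[R]_(m, n)) : measurable_mx (fun=> M).
Proof. by move=> i j; exact: measurable_cst. Qed.

Lemma measurable_adjmx n (M : T -> 'M[R]_n) : measurable_mx M ->
  measurable_mx (fun t => \adj (M t)).
Proof.
move=> mM i j; under eq_fun do rewrite mxE.
apply: measurable_funM => //; apply: measurable_det => k l.
by under eq_fun do rewrite !mxE; exact: mM.
Qed.

(** Cramer's rule: the shifted square is always invertible, so the entries of its inverse are
    quotients of polynomials in the entries of [M]. *)
Lemma measurable_sqres n (M : T -> 'M[R]_n) E eta :
  measurable_mx M -> (forall t, (M t)^T = M t) -> eta != 0 ->
  measurable_mx (fun t => sqres (M t) E eta).
Proof.
move=> mM symM e0 i j.
have mS : measurable_mx (fun t => shifted_square (M t) E eta).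
  have mME : measurable_mx (fun t => M t - E%:M).
    by apply: measurable_addmx => //; exact: measurable_cstmx.
  by apply: measurable_addmx; [exact: measurable_mulmx|exact: measurable_cstmx].
rewrite (_ : (fun _ => _) = fun t => (\det (shifted_square (M t) E eta))^-1 *
    (\adj (shifted_square (M t) E eta)) i j).
  apply: measurable_funM; last exact: measurable_adjmx.
  exact/measurable_inv/measurable_det.
by apply/funext => t; rewrite /sqres /invmx shifted_square_unit// mxE.
Qed.

End MeasurableMatrices.

(** * The Wegner estimate *)

Section Wegner.
Context {R : realType} {N : nat}.
Local Notation gaussian := (normal_prob 0 1 : probability (measurableTypeR R) R).

(** Writing |1 + v x G|^2 = |G|^2 |v x + 1/G|^2 turns the rank-one formula into a Cauchy kernel in
    x, of width Im G / |G|^2. Width and centre depend on [A], but the bound of [gaussian_cauchy_le]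
    sees neither. *)
Lemma gaussian_sqres_le (A : 'M[R]_N) (E eta v : R) (z : 'I_N) :
  A^T = A -> 0 < eta -> 0 < v ->
  (\int[gaussian]_x (eta * sqres (A + (v * x) *: delta_mx z z) E eta z z)%:E
    <= (pi / v)%:E)%E.
Proof.
move=> symA eta0 v0; have etaN0 : eta != 0 by rewrite gt_eqF.
set f := ((A - E%:M) *m sqres A E eta) z z.
set g := eta * sqres A E eta z z.
have g0 : 0 < g by rewrite mulr_gt0// sqres_diag_gt0.
pose m := f ^+ 2 + g ^+ 2.
have m0 : 0 < m by rewrite lorentz_den_gt0// gt_eqF.
apply: le_trans (gaussian_cauchy_le (f / m) (divr_gt0 g0 m0) v0).
rewrite le_eqVlt; apply/orP; left; apply/eqP; apply: eq_integral => x _.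
congr EFin; rewrite sqres_rank_one// -/f -/g.
have D1 : 0 < (v * x + f / m) ^+ 2 + (g / m) ^+ 2.
  by rewrite lorentz_den_gt0// mulf_neq0 ?invr_eq0 ?gt_eqF.
have -> : (1 + v * x * f) ^+ 2 + (v * x * g) ^+ 2 =
    m * ((v * x + f / m) ^+ 2 + (g / m) ^+ 2).
  have -> : (v * x + f / m) ^+ 2 + (g / m) ^+ 2 =
      (v * x) ^+ 2 + 2 * (v * x) * (f / m) + (f ^+ 2 + g ^+ 2) / m ^+ 2.
    by field; rewrite gt_eqF.
  rewrite -/m [RHS](_ : _ = (v * x) ^+ 2 * m + 2 * (v * x) * f + 1).
    by rewrite /m; ring.
  by field; rewrite gt_eqF.
by rewrite invfM mulrA.
Qed.

Context {d : measure_display} {T : measurableType d} (P : probability T R).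
Context {I : finType} (g : I -> T -> R).
Hypothesis gauss_g : forall i, std_gaussian P (g i).
Hypothesis indep_g : mutually_independent P g.

Definition coord_measurable_mx (H : (I -> R) -> 'M[R]_N) :=
  forall i j, coord_measurable (fun h => H h i j).

Lemma wegner (H : (I -> R) -> 'M[R]_N) (k : I) (E eta v : R) (z : 'I_N) :
  coord_measurable_mx H -> (forall h, (H h)^T = H h) -> 0 < eta -> 0 < v ->
  (forall h x, H (upd h k x) = H (upd h k 0) + (v * x) *: delta_mx z z) ->
  (\int[P]_t (eta * sqres (H (g^~ t)) E eta z z)%:E <= (pi / v)%:E)%E.
Proof.
move=> mH symH eta0 v0 Hk; have etaN0 : eta != 0 by rewrite gt_eqF.
have mF : coord_measurable (fun h => eta * sqres (H h) E eta z z).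
  rewrite /coord_measurable; apply: measurable_funM => //.
  by apply: (measurable_sqres (M := H \o of_tuple)) => //=.
have F0 h : 0 <= eta * sqres (H h) E eta z z.
  by rewrite mulr_ge0 ?ltW// sqres_diag_gt0.
apply: (@le_trans _ _ (\int[P]_t (pi / v)%:E)%E); last first.
  by rewrite integral_cst//= probability_setT mule1.
apply: (resample_le gauss_g indep_g (F' := fun=> pi / v) mF _ F0) => // h.
  exact: measurable_cst.
apply: le_trans (gaussian_sqres_le E z (symH (upd h k 0)) eta0 v0).
rewrite le_eqVlt; apply/orP; left; apply/eqP; apply: eq_integral => x _.
by rewrite -Hk.
Qed.

End Wegner.

(** * Perturbation of the resolvent *)

Section Perturbation.
Context {R : realType}.

(** Lagrange's identity: after doubling, the difference of the two sides is a double sum of squares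
    divided by [w i * w j]. *)
Lemma weighted_cauchy_schwarz (I : finType) (w x y : I -> R) :
  (forall i, 0 < w i) ->
  (\sum_i x i * y i) ^+ 2 <= (\sum_i x i ^+ 2 * w i) * (\sum_i y i ^+ 2 / w i).
Proof.
move=> w0; rewrite -(ler_pM2l (ltr0n R 2)).
have -> : 2 * (\sum_i x i * y i) ^+ 2 =
    \sum_i \sum_j 2 * ((x i * y i) * (x j * y j)).
  rewrite expr2 mulr_suml mulr_sumr; apply: eq_bigr => i _.
  by rewrite mulr_sumr mulr_sumr; apply: eq_bigr.
have -> : 2 * ((\sum_i x i ^+ 2 * w i) * (\sum_i y i ^+ 2 / w i)) =
    \sum_i \sum_j ((x i ^+ 2 * w i) * (y j ^+ 2 / w j) +
                   (x j ^+ 2 * w j) * (y i ^+ 2 / w i)).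
  under [RHS]eq_bigr do rewrite big_split /=.
  rewrite big_split /= [X in _ = _ + X]exchange_big /= -mulr2n -[RHS]mulr_natl; congr (_ * _).
  by rewrite mulr_suml; apply: eq_bigr => i _; rewrite mulr_sumr.
apply: ler_sum => i _; apply: ler_sum => j _.
have := w0 i; have := w0 j => wj wi.
have -> : x i ^+ 2 * w i * (y j ^+ 2 / w j) + x j ^+ 2 * w j * (y i ^+ 2 / w i) =
   2 * ((x i * y i) * (x j * y j)) +
   (x i * y j * w i - x j * y i * w j) ^+ 2 / (w i * w j).
  by field; rewrite !gt_eqF.
by rewrite lerDl divr_ge0 ?sqr_ge0// mulr_ge0// ltW.
Qed.

(** This is the equation (a - i eta) f = d - K f in an eigenbasis of the unperturbed matrix. In the
    norm weighted by [w], Cauchy-Schwarz bounds [K f] by the Hilbert-Schmidt quantity [tau] times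
    the residual d - K f. For small [tau] this term is absorbed, although [K] may be large compared
    with eta in operator norm. *)
Lemma perturbed_resolvent_norm (I : finType) (a w d f1 f2 : I -> R)
    (K : I -> I -> R) (eta tau : R) :
  0 < eta -> (forall j, 0 < w j) ->
  (forall j, (a j ^+ 2 + eta ^+ 2)^-1 <= 16 * w j ^+ 2) ->
  (forall j, (a j ^+ 2 + eta ^+ 2)^-1 <= 4 / eta * w j) ->
  (forall j, a j * f1 j + eta * f2 j = d j - \sum_i K j i * f1 i) ->
  (forall j, a j * f2 j - eta * f1 j = - \sum_i K j i * f2 i) ->
  tau = 16 * \sum_i \sum_j w i * w j * K i j ^+ 2 -> tau <= 4^-1 ->
  \sum_j (f1 j ^+ 2 + f2 j ^+ 2) <=
    2 * (\sum_j d j ^+ 2 / (a j ^+ 2 + eta ^+ 2)) +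
    32 * tau / eta * \sum_j w j * d j ^+ 2.
Proof.
move=> eta0 w0 rho1 rho2 e1 e2 tauE tau4.
pose k1 j := \sum_i K j i * f1 i; pose k2 j := \sum_i K j i * f2 i.
pose rho j := (a j ^+ 2 + eta ^+ 2)^-1.
(* [s] is the squared modulus of the residual d - K f, so |f|^2 = rho s coordinatewise. *)
pose s j := (d j - k1 j) ^+ 2 + k2 j ^+ 2.
have rho0 j : 0 < rho j by rewrite invr_gt0 lorentz_den_gt0// gt_eqF.
have fE j : f1 j ^+ 2 + f2 j ^+ 2 = rho j * s j.
  rewrite /s -/(k1 j) -e1 -[k2 j]opprK -e2 sqrrN /rho.
  have := rho0 j; rewrite /rho invr_gt0 => h; field; rewrite gt_eqF//.
have s0 j : 0 <= s j by rewrite addr_ge0 ?sqr_ge0.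
have s_le j : s j <= 2 * d j ^+ 2 + 2 * (k1 j ^+ 2 + k2 j ^+ 2).
  have := sqr_ge0 (d j + k1 j); have := sqr_ge0 (k2 j); rewrite /s; nra.
pose S := \sum_j w j * s j; pose D := \sum_j w j * d j ^+ 2.
pose Sk := \sum_j w j * (k1 j ^+ 2 + k2 j ^+ 2).
have SkS : Sk <= tau * S.
  pose F := \sum_i (f1 i ^+ 2 + f2 i ^+ 2) / w i.
  have kF j : k1 j ^+ 2 + k2 j ^+ 2 <= (\sum_i K j i ^+ 2 * w i) * F.
    rewrite /F; under [X in _ <= _ * X]eq_bigr do rewrite mulrDl.
    by rewrite big_split /= mulrDr lerD// weighted_cauchy_schwarz.
  have F_le : F <= 16 * S.
    rewrite /S mulr_sumr; apply: ler_sum => j _; rewrite fE ler_pdivrMr//.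
    rewrite (_ : 16 * _ * _ = 16 * w j ^+ 2 * s j); last by ring.
    by rewrite ler_wpM2r// rho1.
  have F0 : 0 <= F.
    by apply: sumr_ge0 => j _; rewrite divr_ge0 ?addr_ge0 ?sqr_ge0// ltW.
  apply: (@le_trans _ _ ((\sum_i \sum_j w i * w j * K i j ^+ 2) * F)).
    rewrite mulr_suml; apply: ler_sum => j _.
    apply: (le_trans (ler_wpM2l (ltW (w0 j)) (kF j))).
    rewrite mulrA ler_wpM2r// mulr_sumr; apply: ler_sum => i _.
    by rewrite le_eqVlt; apply/orP; left; apply/eqP; ring.
  rewrite tauE mulrAC [X in _ <= X]mulrC ler_wpM2l//.
  apply: sumr_ge0 => i _; apply: sumr_ge0 => j _.
  by apply: mulr_ge0; [apply: mulr_ge0; exact: ltW|exact: sqr_ge0].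
have S_le : S <= 2 * D + 2 * Sk.
  rewrite /S /D /Sk !mulr_sumr -big_split /=; apply: ler_sum => j _.
  have -> : 2 * (w j * d j ^+ 2) + 2 * (w j * (k1 j ^+ 2 + k2 j ^+ 2)) =
    w j * (2 * d j ^+ 2 + 2 * (k1 j ^+ 2 + k2 j ^+ 2)) by ring.
  by rewrite ler_wpM2l// ltW.
have S0 : 0 <= S by apply: sumr_ge0 => j _; rewrite mulr_ge0// ltW.
have tau0 : 0 <= tau.
  rewrite tauE mulr_ge0//; apply: sumr_ge0 => i _; apply: sumr_ge0 => j _.
  by apply: mulr_ge0; [apply: mulr_ge0; exact: ltW|exact: sqr_ge0].
(* Absorption: S <= 2 D + 2 tau S with tau <= 1/4. *)
have SD : S <= 4 * D.
  have : tau * S <= 4^-1 * S by rewrite ler_wpM2r.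
  lra.
have SkD : Sk <= 4 * tau * D.
  by apply: (le_trans SkS); rewrite [4 * tau]mulrC -mulrA ler_wpM2l.
(* The bound on [K f] is inserted a second time, so that the error keeps the factor [tau] instead of
   a constant. *)
under eq_bigr do rewrite fE.
apply: (@le_trans _ _ (2 * (\sum_j d j ^+ 2 * rho j) + 8 / eta * Sk)).
  rewrite /Sk !mulr_sumr -big_split /=; apply: ler_sum => j _.
  apply: (le_trans (ler_wpM2l (ltW (rho0 j)) (s_le j))).
  rewrite mulrDr lerD//; first by rewrite le_eqVlt; apply/orP; left; apply/eqP; ring.
  rewrite (_ : 8 / eta * _ = 4 / eta * w j * (2 * (k1 j ^+ 2 + k2 j ^+ 2))); last by field; rewrite gt_eqF.
  by rewrite ler_wpM2r ?rho2// mulr_ge0// addr_ge0 ?sqr_ge0.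
rewrite lerD2l (_ : 32 * tau / eta * _ = 8 / eta * (4 * tau * D)).
  by rewrite ler_wpM2l// divr_ge0// ltW.
by rewrite /D; field; rewrite gt_eqF.
Qed.

(** A rational substitute for 1/|a - i eta|: the term whose scale 2^-k is comparable to |a - i eta|
    is already of the right size, and the summand 1 covers |a - i eta| >= 1. The converse bound is
    not pointwise; it holds in mean through Wegner, at the price of a factor n+1. *)
Definition dyadic_weight (n : nat) (a : R) : R :=
  1 + \sum_(k < n.+1) 2 ^- k / (a ^+ 2 + (2 ^- k) ^+ 2).

Lemma dyadic_weight_ge1 n a : 1 <= dyadic_weight n a.
Proof.
rewrite lerDl; apply: sumr_ge0 => k _.
by rewrite divr_ge0 ?invr_ge0 ?exprn_ge0// addr_ge0 ?sqr_ge0.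
Qed.

Lemma dyadic_scale (n : nat) (r : R) : 2 ^- n <= r -> r < 1 ->
  exists2 k : nat, (k <= n)%N & 2 ^- k <= r < 2 * 2 ^- k.
Proof.
elim: n => [|n IH] rn r1; first by move: rn; rewrite expr0 invr1 leNgt r1.
have [/IH|rn'] := leP (2 ^- n) r.
  by move=> /(_ r1)[k kn kr]; exists k => //; exact: leqW.
exists n.+1 => //; rewrite rn /= (lt_le_trans rn')//.
by rewrite exprS invfM mulrA divff ?mul1r.
Qed.

(** If h = 2^-k satisfies h <= r < 2h for r = |a - i eta|, then a^2 + h^2 <= 3 h r, so this single
    term gives the bound. The hypothesis on eta ensures that such a k is at most n. *)
Lemma dyadic_weight_ge n (a eta : R) : 2 ^- n <= eta ->
  (Num.sqrt (a ^+ 2 + eta ^+ 2))^-1 <= 4 * dyadic_weight n a.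
Proof.
move=> eta_n; have eta0 : 0 < eta by rewrite (lt_le_trans _ eta_n)// invr_gt0 exprn_gt0.
have q0 : 0 < a ^+ 2 + eta ^+ 2 by rewrite lorentz_den_gt0// gt_eqF.
set r := Num.sqrt _; have r0 : 0 < r by rewrite sqrtr_gt0.
have r2 : r ^+ 2 = a ^+ 2 + eta ^+ 2 by rewrite sqr_sqrtr// ltW.
have [r1|r1] := leP 1 r.
  apply: (@le_trans _ _ 1); first by rewrite invf_le1.
  by have := dyadic_weight_ge1 n a; lra.
have rn : 2 ^- n <= r.
  apply: (le_trans eta_n); rewrite -ler_sqr ?nnegrE ?(ltW eta0) ?(ltW r0)//.
  by rewrite r2 lerDr sqr_ge0.
have [k kn /andP[kr rk]] := dyadic_scale rn r1.
set h : R := 2 ^- k in kr rk *.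
have h0 : 0 < h by rewrite invr_gt0 exprn_gt0.
have term_le : h / (a ^+ 2 + h ^+ 2) <= dyadic_weight n a.
  rewrite /dyadic_weight (bigD1 (Ordinal (kn : (k < n.+1)%N)))//= -/h.
  have : 0 <= \sum_(i < n.+1 | i != Ordinal (kn : (k < n.+1)%N))
      2 ^- i / (a ^+ 2 + (2 ^- i) ^+ 2) :> R.
    apply: sumr_ge0 => i _.
    by rewrite divr_ge0 ?invr_ge0 ?exprn_ge0// addr_ge0 ?sqr_ge0.
  lra.
apply: (@le_trans _ _ (4 * (h / (a ^+ 2 + h ^+ 2)))); last by rewrite ler_wpM2l.
have ah0 : 0 < a ^+ 2 + h ^+ 2 by rewrite lorentz_den_gt0// gt_eqF.
rewrite mulrA -[leLHS]mul1r ler_pdivrMr// mulrAC ler_pdivlMr//.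
have a2 : a ^+ 2 <= r ^+ 2 by rewrite r2 lerDl sqr_ge0.
have := sqr_ge0 a; nra.
Qed.

End Perturbation.

Section MatrixPerturbation.
Context {R : realType} {N : nat}.
Implicit Types (A K O : 'M[R]_N) (l : 'rV[R]_N) (E eta : R).

(* A positive matrix dominating |A - E - i eta|^-1 for all eta >= 2^-n up to a
   constant, built from rational functions of A only so that it depends
   measurably on A. *)
Definition abs_resolvent (n : nat) A E : 'M[R]_N :=
  1%:M + \sum_(k < n.+1) 2 ^- k *: sqres A E (2 ^- k).

Lemma abs_resolvent_spectral n A O l E : O^T *m O = 1%:M ->
  A = O *m diag_mx l *m O^T ->
  abs_resolvent n A E = O *m diag_mx (\row_j dyadic_weight n (l 0 j - E)) *m O^T.
Proof.
move=> OO AE; have OO' := orthoC OO.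
have two_neq0 k : (2 ^- k : R) != 0 by rewrite invr_eq0 expf_neq0.
apply/matrixP => x y; rewrite spectral_entry mxE summxE.
have -> : (1%:M : 'M[R]_N) x y = \sum_j O x j * O y j.
  rewrite -OO' mxE; by apply: eq_bigr => j _; rewrite mxE.
have -> : \sum_(k < n.+1) (2 ^- k *: sqres A E (2 ^- k)) x y =
    \sum_j O x j * O y j * \sum_(k < n.+1) 2 ^- k / ((l 0 j - E) ^+ 2 + (2 ^- k) ^+ 2).
  under [RHS]eq_bigr do rewrite mulr_sumr.
  rewrite exchange_big; apply: eq_bigr => k _.
  rewrite mxE (sqres_spectral E OO (two_neq0 k) AE).2 spectral_entry mulr_sumr.
  by apply: eq_bigr => j _; rewrite mxE mulrCA mulrA.
rewrite -big_split /=; apply: eq_bigr => j _.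
by rewrite mxE /dyadic_weight mulrDr mulr1.
Qed.

Lemma abs_resolvent_diag_gt0 n A E x : A^T = A -> 0 < abs_resolvent n A E x x.
Proof.
move=> symA; rewrite mxE summxE mxE eqxx ltr_wpDr//.
apply: sumr_ge0 => k _; rewrite mxE mulr_ge0 ?invr_ge0 ?exprn_ge0//.
by rewrite ltW// sqres_diag_gt0// invr_eq0 expf_neq0.
Qed.

Lemma abs_resolvent_sym n A E : A^T = A -> (abs_resolvent n A E)^T = abs_resolvent n A E.
Proof.
move=> symA; rewrite linearD /= tr_scalar_mx linear_sum /=; congr (_ + _).
by apply: eq_bigr => k _; rewrite linearZ /= sqres_sym.
Qed.

(** [perturbed_resolvent_norm] in an eigenbasis of [A], for the vector f = (A + K - E - i eta)^-1
    e_x, whose squared norm is the diagonal entry to be bounded. *)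
Lemma sqres_perturbation n A K E eta x : A^T = A -> K^T = K ->
  0 < eta -> 2 ^- n <= eta ->
  let W := abs_resolvent n A E in
  let tau := 16 * \tr (W *m K *m W *m K) in
  tau <= 4^-1 ->
  sqres (A + K) E eta x x <= 2 * sqres A E eta x x + 32 * tau / eta * W x x.
Proof.
move=> symA symK eta0 eta_n W tau tau4.
have etaN0 : eta != 0 by rewrite gt_eqF.
have [V [l [VV AE]]] := symmetric_spectral symA.
have VV' := orthoC VV.
pose w j := dyadic_weight n (l 0 j - E).
have WE : W = V *m diag_mx (\row_j w j) *m V^T by rewrite /W (abs_resolvent_spectral n E VV AE).
pose KO : 'M[R]_N := V^T *m K *m V.
have symAK : (A + K)^T = A + K by rewrite linearD /= symA symK.
have [e1 e2] := resolvent_vector E x symAK etaN0.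
set q := eta *: col x (sqres (A + K) E eta) in e1 e2.
set p := _ *m col x _ in e1 e2.
pose f1 := V^T *m p; pose f2 := V^T *m q.
have pE : p = V *m f1 by rewrite mulmxA VV' mul1mx.
have qE : q = V *m f2 by rewrite mulmxA VV' mul1mx.
have normE (v : 'cV[R]_N) : \sum_j (V^T *m v) j 0 ^+ 2 = (v^T *m v) 0 0.
  transitivity (((V^T *m v)^T *m (V^T *m v)) 0 0).
    by rewrite mxE; apply: eq_bigr => j _; rewrite [in RHS]mxE expr2.
  by rewrite trmx_mul trmxK mulmxA -(mulmxA _ V) VV' mulmx1.
(* With s the [x] column of the perturbed [sqres], p = (A + K - E) s and q = eta s, hence |p|^2 +
   |q|^2 = s^T ((A + K - E) p + eta q) = s^T e_x. *)
have f_norm : \sum_j (f1 j 0 ^+ 2 + f2 j 0 ^+ 2) = sqres (A + K) E eta x x.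
  rewrite big_split /= !normE.
  have pp : p^T *m p + q^T *m q = row x (sqres (A + K) E eta) *m delta_mx x 0.
    rewrite -e1 mulmxDr; congr (_ + _).
      rewrite /p trmx_mul -!mulmxA; congr (_ *m _).
        by rewrite tr_col sqres_sym.
      by rewrite linearB /= symAK tr_scalar_mx.
    have -> : q^T = eta *: row x (sqres (A + K) E eta).
      by rewrite /q linearZ /= tr_col sqres_sym.
    by rewrite -scalemxAl scalemxAr.
  move/matrixP/(_ 0 0) : pp; rewrite mxE => ->.
  by rewrite -colE !mxE.
have conjE : V^T *m (A + K - E%:M) *m V = diag_mx l - E%:M + KO.
  rewrite addrAC mulmxDr mulmxDl; congr (_ + _); rewrite mulmxBr mulmxBl; congr (_ - _).
    by rewrite AE !mulmxA VV mul1mx -mulmxA VV mulmx1.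
  by rewrite mul_mx_scalar -scalemxAl VV scalemx1.
have eqO (v : 'cV[R]_N) j : (V^T *m ((A + K - E%:M) *m (V *m v))) j 0 =
    (l 0 j - E) * v j 0 + \sum_i KO j i * v i 0.
  rewrite !mulmxA conjE mulmxDl mulmxBl mul_diag_mx mul_scalar_mx !mxE; congr (_ + _); ring.
have trE : \tr (W *m K *m W *m K) = \sum_i \sum_j w i * w j * KO i j ^+ 2.
  have symKO i j : KO j i = KO i j.
    have : KO^T = KO by rewrite /KO !trmx_mul trmxK symK mulmxA.
    by move=> e; rewrite -{1}e mxE.
  have -> : \tr (W *m K *m W *m K) =
      \tr (diag_mx (\row_j w j) *m KO *m (diag_mx (\row_j w j) *m KO)).
    rewrite WE; set D := diag_mx _.
    have -> : V *m D *m V^T *m K *m (V *m D *m V^T) *m K =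
      V *m (D *m V^T *m K *m V *m D *m V^T *m K) by rewrite !mulmxA.
    by rewrite mxtrace_mulC /KO !mulmxA.
  rewrite /mxtrace; apply: eq_bigr => i _; rewrite mxE; apply: eq_bigr => j _.
  rewrite !mul_diag_mx; move: symKO; move: (KO) => M symM.
  by rewrite !mxE (symM i j); ring.
have w0 j : 0 < w j by exact: lt_le_trans ltr01 (dyadic_weight_ge1 _ _).
have rho_gt0 j : 0 < (l 0 j - E) ^+ 2 + eta ^+ 2 by rewrite lorentz_den_gt0.
have := @perturbed_resolvent_norm R 'I_N (fun j => l 0 j - E) w (fun j => V x j)
  (fun j => f1 j 0) (fun j => f2 j 0) (fun i j => KO i j) eta tau eta0 w0.
rewrite f_norm (sqres_diagE E x VV etaN0 AE).
have -> : W x x = \sum_j w j * V x j ^+ 2.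
  by rewrite WE spectral_entry; apply: eq_bigr => j _; rewrite mxE -expr2 mulrC.
apply => //.
- move=> j; have := dyadic_weight_ge (l 0 j - E) eta_n.
  set r := Num.sqrt _ => rw.
  have r0 : 0 < r by rewrite sqrtr_gt0.
  have -> : (l 0 j - E) ^+ 2 + eta ^+ 2 = r ^+ 2 by rewrite sqr_sqrtr// ltW.
  have -> : 16 * w j ^+ 2 = (4 * w j) ^+ 2 by ring.
  by rewrite -exprVn ler_sqr// nnegrE ?invr_ge0 ?mulr_ge0// ltW.
- move=> j; have := dyadic_weight_ge (l 0 j - E) eta_n.
  set r := Num.sqrt _ => rw.
  have r0 : 0 < r by rewrite sqrtr_gt0.
  have r2 : (l 0 j - E) ^+ 2 + eta ^+ 2 = r ^+ 2 by rewrite sqr_sqrtr// ltW.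
  have eta_r : eta <= r.
    by rewrite -ler_sqr ?nnegrE ?(ltW eta0) ?(ltW r0)// -r2 lerDr sqr_ge0.
  rewrite r2 expr2 invfM mulrAC.
  by apply: ler_pM; rewrite ?invr_ge0 ?(ltW r0)// lef_pV2.
- move=> j; have := congr1 (fun v : 'cV[R]_N => (V^T *m v) j 0) e1.
  rewrite {1}pE mulmxDr mxE eqO -scalemxAr -/f2 -colE [RHS]mxE [RHS]mxE => <-.
  have -> : (eta *: f2) j 0 = eta * f2 j 0 by rewrite mxE.
  ring.
- move=> j; have := congr1 (fun v : 'cV[R]_N => (V^T *m v) j 0) e2.
  rewrite {1}qE eqO -scalemxAr -/f1 [RHS]mxE => <-; ring.
- by rewrite /tau trE.
Qed.

End MatrixPerturbation.

(** * Measurability of the correlator event *)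

Section MeasurableExists.
Context {R : realType} {d : measure_display} {T : measurableType d}.

Let ultra_bounded_cvg (X : Type) (G : set_system X) (u : X -> R) (b : R) :
  UltraFilter G -> (forall x, `|u x| <= b) -> exists l : R, u x @[x --> G] --> l.
Proof.
move=> GU ub; have GP : ProperFilter G by exact: ultra_proper.
have uAb : (u @ G) `[- b, b]%classic.
  by apply: (@filterE _ G) => x; rewrite /= in_itv /= -ler_norml.
have [l [_ lcl]] := @segment_compact R (- b) b (u @ G) _ uAb.
exists l => A lA; have [//|GA] := in_ultra_setVsetC (u @^-1` A) GU.
by have [x [nAx]] := lcl (~` A) A GA lA.
Qed.

(* Existential quantification over a bounded finite-dimensional parameter
   preserves measurability: by density of the rationals and compactness, a zero
   exists iff some rational point is an approximate zero at every scale. *)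
Lemma measurable_exists_zero (J : finType) (f : T -> (J -> R) -> R) :
  (forall U, measurable_fun setT (f ^~ U)) ->
  (forall t U, 0 <= f t U) ->
  (forall t U, f t U < 1 -> forall j, `|U j| <= 2) ->
  (forall t (F : set_system nat) (u : nat -> J -> R) (U : J -> R), ProperFilter F ->
     (forall j, u k j @[k --> F] --> U j) -> f t (u k) @[k --> F] --> f t U) ->
  measurable [set t | exists U, f t U = 0].
Proof.
move=> mf f0 bf cf.
pose q2r (q : {ffun J -> rat}) : J -> R := fun j => ratr (q j).
have -> : [set t | exists U, f t U = 0] =
    \bigcap_(k : nat) \bigcup_(q : {ffun J -> rat}) [set t | f t (q2r q) < k.+1%:R^-1].
  apply/seteqP; split=> t /=.
    move=> [U fU] k _.
    have dense m j : exists q : rat, `|ratr q - U j| < m.+1%:R^-1.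
      have /rat_in_itvoo[q] : U j < U j + m.+1%:R^-1 by rewrite ltrDl invr_gt0.
      rewrite in_itv /= => /andP[q1 q2]; exists q.
      by rewrite gtr0_norm ?subr_gt0// ltrBlDl.
    pose Q m := [ffun j => projT1 (cid (dense m j))] : {ffun J -> rat}.
    have Qcvg j : q2r (Q m) j @[m --> \oo] --> U j.
      apply/cvgrPdist_lt => e e0; have := near_infty_natSinv_lt (PosNum e0).
      apply: filterS => m /= me; rewrite /q2r ffunE; case: cid => q /= qU.
      by rewrite distrC (lt_trans qU).
    have fU_cvg : f t (q2r (Q m)) @[m --> \oo] --> f t U.
      by apply: cf => j; exact: Qcvg.
    move/cvgrPdist_lt : fU_cvg => near_fU.
    have k0 : 0 < k.+1%:R^-1 :> R by rewrite invr_gt0.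
    have [M _ /(_ M (leqnn _))] := near_fU _ k0.
    rewrite /=; rewrite fU sub0r normrN ger0_norm// => fM; by exists (Q M).
  move=> H; have Hk k : exists q : {ffun J -> rat}, f t (q2r q) < k.+1%:R^-1.
    by have [q _ hq] := H k I; exists q.
  pose u k := q2r (projT1 (cid (Hk k))).
  have fu k : f t (u k) < k.+1%:R^-1 by rewrite /u; case: cid.
  have ub k j : `|u k j| <= 2.
    by apply: (bf t); apply: (lt_le_trans (fu k)); rewrite invf_le1// ler1n.
  (* An ultrafilter makes all coordinates of the approximate zeros converge at once, without
     extracting a subsequence coordinate by coordinate. *)
  have [G [GU sG]] := ultraFilterLemma (_ : ProperFilter \oo%classic).
  have GP : ProperFilter G by exact: ultra_proper.
  have lims j : exists l : R, u k j @[k --> G] --> l.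
    exact: (@ultra_bounded_cvg _ _ (fun k => u k j) 2).
  pose U j := projT1 (cid (lims j)).
  have UP j : u k j @[k --> G] --> U j by rewrite /U; case: cid.
  exists U.
  have f_cvg := cf t G u U GP UP.
  have f_cvg0 : f t (u k) @[k --> G] --> (0 : R).
    apply/cvgrPdist_lt => e e0; apply: sG.
    have := near_infty_natSinv_lt (PosNum e0).
    by apply: filterS => k /= ke; rewrite sub0r normrN ger0_norm// (lt_trans (fu k)).
  exact: (@cvg_unique R (@norm_hausdorff _ _) (f t (u k) @[k --> G])).
apply: bigcap_measurableType => k _.
apply: countable_bigcupT_measurable => [|q]; first exact: countableP.
rewrite (_ : [set t | _] = setT `&` (f ^~ (q2r q)) @^-1` `]-oo, k.+1%:R^-1[).
  exact: mf.
by apply/seteqP; split=> t /=; rewrite in_itv /=; [|case].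
Qed.

End MeasurableExists.

Section EigenfunctionEvent.
Context {R : realType} {d : measure_display} {T : measurableType d} {N : nat}.
Implicit Types (H U : 'M[R]_N) (a b s : R) (x : 'I_N) (Y : pred 'I_N) (L : {set 'I_N}).

Let entry (u : 'I_N * 'I_N -> R) : 'M[R]_N := \matrix_(i, j) u (i, j).

(** Eigenvalues are recovered as quadratic forms in the eigenvectors, so the only unknown is the
    matrix [u], which near-orthonormality keeps bounded. *)
Let lam H (u : 'I_N * 'I_N -> R) (k : 'I_N) : R :=
  \sum_i u (i, k) * \sum_j H i j * u (j, k).

(** Twice the positive part: it encodes the inequality v <= 0 as the vanishing of a continuous
    function. *)
Let excess (v : R) : R := `|v| + v.

Let excess_ge0 v : 0 <= excess v.
Proof. by rewrite /excess -lerBlDr sub0r -normrN ler_norm. Qed.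

Let excess_eq0 v : excess v = 0 -> v <= 0.
Proof. by rewrite /excess => /eqP; rewrite addr_eq0 => /eqP h; have := normr_ge0 v; lra. Qed.

Let le0_excess v : v <= 0 -> excess v = 0.
Proof. by move=> v0; rewrite /excess ler0_norm// addNr. Qed.

Let ortho_defect (u : 'I_N * 'I_N -> R) : R :=
  \sum_i \sum_j `|\sum_k u (k, i) * u (k, j) - (i == j)%:R|.

Let eigen_defect H (u : 'I_N * 'I_N -> R) : R :=
  \sum_i \sum_j `|\sum_k H i k * u (k, j) - u (i, j) * lam H u j|.

Let window_defect H L a b (u : 'I_N * 'I_N -> R) : R :=
  \sum_(k in L) (excess (a - lam H u k) + excess (lam H u k - b)).

Let mass_defect L s x Y (u : 'I_N * 'I_N -> R) : R :=
  excess (s - \sum_(y | Y y) \sum_(k in L) `|u (x, k) * u (y, k)|).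

(** The indicator of the window is discontinuous in the eigenvalue. The set [L] of indices required
    to lie in the window is therefore a separate discrete parameter, and the defect is continuous in
    [u] for each fixed [L]. *)
Let defect H L a b s x Y (u : 'I_N * 'I_N -> R) : R :=
  ortho_defect u + eigen_defect H u + window_defect H L a b u + mass_defect L s x Y u.

Let ortho_defect_ge0 u : 0 <= ortho_defect u.
Proof. by apply: sumr_ge0 => i _; apply: sumr_ge0. Qed.

Let eigen_defect_ge0 H u : 0 <= eigen_defect H u.
Proof. by apply: sumr_ge0 => i _; apply: sumr_ge0. Qed.

Let window_defect_ge0 H L a b u : 0 <= window_defect H L a b u.
Proof. by apply: sumr_ge0 => i _; rewrite addr_ge0. Qed.

Let defect_ge0 H L a b s x Y u : 0 <= defect H L a b s x Y u.
Proof. by apply: addr_ge0; [rewrite !addr_ge0|exact: excess_ge0]. Qed.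

Let defect_bounded H L a b s x Y u : defect H L a b s x Y u < 1 -> forall j, `|u j| <= 2.
Proof.
move=> lt1 [i j].
have term : `|\sum_k u (k, j) * u (k, j) - 1| < 1.
  apply: (@le_lt_trans _ _ (ortho_defect u)).
    rewrite /ortho_defect [leRHS](bigD1 j)//= [X in _ <= X + _](bigD1 j)//= eqxx -addrA lerDl addr_ge0//.
      by apply: sumr_ge0.
    by apply: sumr_ge0 => k _; apply: sumr_ge0.
  apply: le_lt_trans lt1; rewrite /defect -!addrA lerDl.
  by rewrite addr_ge0// addr_ge0// excess_ge0.
have : u (i, j) ^+ 2 < 2.
  have : u (i, j) ^+ 2 <= \sum_k u (k, j) * u (k, j).
    rewrite (bigD1 i)//= expr2 lerDl; apply: sumr_ge0 => k _.
    by rewrite -expr2 sqr_ge0.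
  by move: term; rewrite ltr_norml => /andP[]; lra.
rewrite -real_normK ?num_real// => h; rewrite leNgt; apply/negP => h2; nra.
Qed.

Let cvg_sumr (X I : Type) (F : set_system X) (r : seq I) (P : pred I)
    (f : I -> X -> R) (l : I -> R) : Filter F ->
  (forall i, f i t @[t --> F] --> l i) ->
  \sum_(i <- r | P i) f i t @[t --> F] --> \sum_(i <- r | P i) l i.
Proof.
move=> FF fl; elim: r => [|i r IH].
  by rewrite big_nil; under eq_fun do rewrite big_nil; exact: cvg_cst.
rewrite big_cons; under eq_fun do rewrite big_cons.
by case: (P i) => //; exact: cvgD.
Qed.

Let defect_cvg H L a b s x Y (F : set_system nat) (u : nat -> _) v : ProperFilter F ->
  (forall j, u k j @[k --> F] --> v j) ->
  defect H L a b s x Y (u k) @[k --> F] --> defect H L a b s x Y v.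
Proof.
move=> FF uv.
have cvg_lam k : lam H (u t) k @[t --> F] --> lam H v k.
  apply: cvg_sumr => i; apply: cvgM; first exact: uv.
  by apply: cvg_sumr => j; apply: cvgM; [exact: cvg_cst|exact: uv].
have cvg_excess (f : nat -> R) l : f t @[t --> F] --> l -> excess (f t) @[t --> F] --> excess l.
  by move=> fl; apply: cvgD => //; exact: cvg_norm.
apply: cvgD; last first.
  apply: cvg_excess; apply: cvgB; first exact: cvg_cst.
  apply: cvg_sumr => y; apply: cvg_sumr => k; apply: cvg_norm.
  by apply: cvgM; exact: uv.
apply: cvgD; last first.
  apply: cvg_sumr => k; apply: cvgD; apply: cvg_excess; apply: cvgB => //; exact: cvg_cst.
apply: cvgD; apply: cvg_sumr => i; apply: cvg_sumr => j; apply: cvg_norm; apply: cvgB.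
- by apply: cvg_sumr => k; apply: cvgM; exact: uv.
- exact: cvg_cst.
- by apply: cvg_sumr => k; apply: cvgM; [exact: cvg_cst|exact: uv].
- by apply: cvgM.
Qed.

Let measurable_defect (H : T -> 'M[R]_N) L a b s x Y u : measurable_mx H ->
  measurable_fun setT (fun t => defect (H t) L a b s x Y u).
Proof.
move=> mH.
have mlam k : measurable_fun setT (fun t => lam (H t) u k).
  apply: measurable_sum => i; apply: measurable_funM => //.
  by apply: measurable_sum => j; apply: measurable_funM.
have mexcess (f : T -> R) : measurable_fun setT f -> measurable_fun setT (fun t => excess (f t)).
  by move=> mf; apply: measurable_funD => //; exact: measurableT_comp.
have mnorm (f : T -> R) : measurable_fun setT f -> measurable_fun setT (fun t => `|f t|).
  by move=> mf; exact: measurableT_comp.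
apply: measurable_funD; last by apply: mexcess; exact: measurable_cst.
apply: measurable_funD; last first.
  apply: measurable_sum_cond => k.
  by apply: measurable_funD; apply: mexcess; exact: measurable_funB.
apply: measurable_funD; first exact: measurable_cst.
apply: measurable_sum => i; apply: measurable_sum => j; apply: mnorm.
apply: measurable_funB; last exact: measurable_funM.
by apply: measurable_sum => k; exact: measurable_funM.
Qed.

Let defect_eq0P H L a b s x Y :
  (exists u, defect H L a b s x Y u = 0) <->
  exists U (l : 'I_N -> R), [/\ eigenbasis H U l, (forall k, k \in L -> l k \in `[a, b]) &
     s <= \sum_(y | Y y) \sum_(k in L) `|U x k * U y k|].
Proof.
split=> [[u u0]|[U [l [[UU HU] lL sU]]]].
  have [i0 e0 w0 m0] : [/\ ortho_defect u = 0, eigen_defect H u = 0,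
      window_defect H L a b u = 0 & mass_defect L s x Y u = 0].
    have := ortho_defect_ge0 u; have := eigen_defect_ge0 H u.
    have := window_defect_ge0 H L a b u.
    have : 0 <= mass_defect L s x Y u by exact: excess_ge0.
    by move: u0; rewrite /defect => ? ? ? ? ?; split; lra.
  exists (entry u), (lam H u); split.
  - split; apply/matrixP => i j; rewrite ?mul_mx_diag !mxE.
      have /psumr_eq0P/(_ i isT) := i0.
      move=> /(_ (fun i _ => sumr_ge0 _ (fun j _ => normr_ge0 _))) /psumr_eq0P.
      move=> /(_ (fun j _ => normr_ge0 _))/(_ j isT)/normr0_eq0/eqP.
      rewrite subr_eq0 => /eqP <-; apply: eq_bigr => k _; by rewrite !mxE.
    have /psumr_eq0P/(_ i isT) := e0.
    move=> /(_ (fun i _ => sumr_ge0 _ (fun j _ => normr_ge0 _))) /psumr_eq0P.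
    move=> /(_ (fun j _ => normr_ge0 _))/(_ j isT)/normr0_eq0/eqP.
    rewrite subr_eq0 => /eqP <-; apply: eq_bigr => k _; by rewrite !mxE.
  - move=> k kL; have /psumr_eq0P := w0.
    move=> /(_ (fun k _ => addr_ge0 (excess_ge0 _) (excess_ge0 _)))/(_ k kL) e.
    have := excess_ge0 (a - lam H u k); have := excess_ge0 (lam H u k - b) => h1 h2.
    have /excess_eq0 : excess (a - lam H u k) = 0 by lra.
    have /excess_eq0 : excess (lam H u k - b) = 0 by lra.
    by rewrite in_itv /=; lra.
  - have /excess_eq0 := m0; rewrite subr_le0 => /le_trans; apply.
    rewrite le_eqVlt; apply/orP; left; apply/eqP; apply: eq_bigr => y _.
    by apply: eq_bigr => k _; rewrite !mxE.
pose u p := U p.1 p.2.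
have lamE k : lam H u k = l k.
  have : (U^T *m (H *m U)) k k = l k.
    by rewrite HU mulmxA UU mul1mx !mxE eqxx mulr1n.
  move=> <-; rewrite mxE; apply: eq_bigr => i _; rewrite mxE; congr (_ * _).
  by rewrite mxE.
exists u; rewrite /defect.
have -> : ortho_defect u = 0.
  apply: big1 => i _; apply: big1 => j _; apply/normr0P; rewrite subr_eq0.
  have /matrixP/(_ i j) := UU; rewrite !mxE => <-; apply/eqP; apply: eq_bigr => k _.
  by rewrite mxE.
have -> : eigen_defect H u = 0.
  apply: big1 => i _; apply: big1 => j _; apply/normr0P; rewrite subr_eq0 lamE.
  by have /matrixP/(_ i j) := HU; rewrite mul_mx_diag !mxE => <-.
have -> : window_defect H L a b u = 0.
  apply: big1 => k kL; have := lL k kL; rewrite in_itv lamE /= => /andP[ak kb].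
  by rewrite !le0_excess ?addr0// subr_le0.
by rewrite !add0r; apply: le0_excess; rewrite subr_le0.
Qed.

(** The event quantifies over all eigenbases, an uncountable choice, so its measurability is not
    automatic. It is a countable union over [L] and over margins 1/(k+1), the margin replacing the
    strict inequality by a closed condition. *)
Lemma measurable_correlator_event (H : T -> 'M[R]_N) a b s x Y : measurable_mx H ->
  measurable [set t | exists (U : 'M[R]_N) (l : 'I_N -> R),
    eigenbasis (H t) U l /\ \sum_(y | Y y) Qcorr U l a b x y > s].
Proof.
move=> mH.
have -> : [set t | exists (U : 'M[R]_N) (l : 'I_N -> R),
    eigenbasis (H t) U l /\ \sum_(y | Y y) Qcorr U l a b x y > s] =
  \bigcup_(L in [set: {set 'I_N}]) \bigcup_(k : nat)
    [set t | exists u, defect (H t) L a b (s + k.+1%:R^-1) x Y u = 0].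
  apply/seteqP; split=> t /=.
    move=> [U [l [UlH /ltr_add_invr[k sk]]]].
    exists [set k | l k \in `[a, b]]%SET => //; exists k => //=.
    apply/defect_eq0P; exists U, l; split=> // [i|]; first by rewrite inE.
    apply: (le_trans (ltW sk)); rewrite le_eqVlt; apply/orP; left; apply/eqP.
    by apply: eq_bigr => y _; rewrite /Qcorr; apply: eq_bigl => i; rewrite [RHS]inE.
  move=> [L _ [k _ /= /defect_eq0P[U [l [UlH lL sU]]]]]; exists U, l; split=> //.
  apply: (@lt_le_trans _ _ (s + k.+1%:R^-1)); first by rewrite ltrDl invr_gt0.
  (* [L] may miss some indices in the window; their terms are nonnegative and only increase the
     correlator. *)
  apply: (le_trans sU); apply: ler_sum => y _; rewrite /Qcorr.
  rewrite big_mkcond [leRHS]big_mkcond; apply: ler_sum => i _.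
  by case: ifP => [/lL -> //|_]; case: ifP.
apply: fin_bigcup_measurable => [|L _]; first exact: finite_finset.
apply: bigcupT_measurable => k.
apply: measurable_exists_zero.
- by move=> U; exact: measurable_defect.
- by move=> t U; exact: defect_ge0.
- by move=> t U; exact: defect_bounded.
- by move=> t F u U FF uU; exact: defect_cvg.
Qed.

End EigenfunctionEvent.

(** * Expectation of the weighted norm of K *)

Section PositiveWeight.
Context {R : realType} {N : nat}.
Implicit Types (A K : 'M[R]_N) (E : R).

(** In an eigenbasis of [A] the trace is the sum of w_i w_j M_ij^2, where [M] is [K] in that
    basis. *)
Lemma abs_resolvent_tr_ge0 n A K E : A^T = A -> K^T = K ->
  0 <= \tr (abs_resolvent n A E *m K *m abs_resolvent n A E *m K).
Proof.
move=> /symmetric_spectral[V [l [VV AE]]] symK.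
rewrite (abs_resolvent_spectral n E VV AE); set D := diag_mx _.
have -> : V *m D *m V^T *m K *m (V *m D *m V^T) *m K =
  V *m (D *m V^T *m K *m V *m D *m V^T *m K) by rewrite !mulmxA.
rewrite mxtrace_mulC.
have -> : D *m V^T *m K *m V *m D *m V^T *m K *m V =
  D *m (V^T *m K *m V) *m (D *m (V^T *m K *m V)) by rewrite !mulmxA.
have : (V^T *m K *m V)^T = V^T *m K *m V by rewrite !trmx_mul trmxK symK mulmxA.
move: (V^T *m K *m V) => M symM; apply: sumr_ge0 => i _; rewrite mxE.
apply: sumr_ge0 => j _; rewrite !mul_diag_mx -{2}symM !mxE.
have -> : dyadic_weight n (l 0 i - E) * M i j * (dyadic_weight n (l 0 j - E) * M i j) =
  dyadic_weight n (l 0 i - E) * dyadic_weight n (l 0 j - E) * M i j ^+ 2 by ring.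
by rewrite mulr_ge0 ?sqr_ge0// mulr_ge0// (le_trans ler01)// dyadic_weight_ge1.
Qed.

Lemma abs_resolvent_offdiag n A E p q : A^T = A ->
  abs_resolvent n A E p q ^+ 2 <= abs_resolvent n A E p p * abs_resolvent n A E q q.
Proof.
move=> /symmetric_spectral[V [l [VV AE]]].
pose w j := dyadic_weight n (l 0 j - E).
have w0 j : 0 < w j by rewrite (lt_le_trans ltr01)// dyadic_weight_ge1.
have WE x y : abs_resolvent n A E x y = \sum_j V x j * V y j * w j.
  by rewrite (abs_resolvent_spectral n E VV AE) spectral_entry; apply: eq_bigr => j _; rewrite mxE.
rewrite !WE.
have -> : \sum_j V p j * V q j * w j = \sum_j V p j * (V q j * w j).
  by apply: eq_bigr => j _; rewrite mulrA.
apply: (le_trans (weighted_cauchy_schwarz _ _ w0)).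
rewrite le_eqVlt; apply/orP; left; apply/eqP; congr (_ * _).
apply: eq_bigr => j _; field; by rewrite gt_eqF.
Qed.

End PositiveWeight.

Section QuadraticExpectation.
Context {R : realType} {N : nat}.
Context {d : measure_display} {T : measurableType d} (P : probability T R).
Context {I : finType} (g : I -> T -> R).
Hypothesis gauss_g : forall i, std_gaussian P (g i).
Hypothesis indep_g : mutually_independent P g.

Definition sym_delta (p q : 'I_N) : 'M[R]_N := delta_mx p q + delta_mx q p.

Let sym_deltaT p q : (sym_delta p q)^T = sym_delta p q.
Proof. by rewrite /sym_delta linearD /= !trmx_delta addrC. Qed.

Lemma tr_mul_delta (A : 'M[R]_N) p q : \tr (A *m delta_mx p q) = A q p.
Proof.
rewrite /mxtrace (bigD1 q)//= big1 => [|i iq]; rewrite mxE (bigD1 p)//= big1 => [|j jp].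
- by rewrite mxE !eqxx mulr1 !addr0.
- by rewrite mxE (negbTE jp) mulr0.
- by rewrite mxE eqxx (negbTE iq) mulr0 addr0.
- by rewrite mxE (negbTE jp) mulr0.
Qed.

Let delta_mul (W : 'M[R]_N) p q i j : (W *m delta_mx p q *m W) i j = W i p * W q j.
Proof.
rewrite mxE (bigD1 q)//= big1 => [|k kq]; rewrite mxE (bigD1 p)//= big1 => [|l lp].
- by rewrite mxE !eqxx mulr1 !addr0.
- by rewrite mxE (negbTE lp) mulr0.
- by rewrite mxE eqxx (negbTE kq) mulr0 addr0 mul0r.
- by rewrite mxE (negbTE lp) mulr0.
Qed.

Lemma tr_sym_delta (W : 'M[R]_N) p q : W^T = W ->
  \tr (W *m sym_delta p q *m W *m sym_delta p q) = 2 * (W p p * W q q) + 2 * W p q ^+ 2.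
Proof.
move=> symW; have qp : W q p = W p q by rewrite -{1}symW mxE.
have e x y : (W *m sym_delta p q *m W) x y = W x p * W q y + W x q * W p y.
  by rewrite /sym_delta mulmxDr mulmxDl mxE !delta_mul.
rewrite {2}/sym_delta mulmxDr linearD /= !tr_mul_delta !e qp; ring.
Qed.

Let tr_quadratic (M K D : 'M[R]_N) (x : R) :
  \tr (M *m (x *: D + K) *m M *m (x *: D + K)) = \tr (M *m K *m M *m K) +
  x * (\tr (M *m K *m M *m D) + \tr (M *m D *m M *m K)) +
  x ^+ 2 * \tr (M *m D *m M *m D).
Proof.
rewrite -!(mulmxA (M *m _)) mulmxDr -scalemxAr; move: (M *m D) (M *m K) => U V.
rewrite mulmxDl !mulmxDr -!scalemxAl -!scalemxAr !linearD /= !linearZ /=; ring.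
Qed.

Variables (W : (I -> R) -> 'M[R]_N) (c : I -> R) (a b : I -> 'I_N).
Hypothesis mW : coord_measurable_mx W.
Hypothesis symW : forall h, (W h)^T = W h.
Hypothesis trW_gt0 : forall h, 0 < \tr (W h).
Hypothesis W_ge0 : forall h (K : 'M[R]_N), K^T = K -> 0 <= \tr (W h *m K *m W h *m K).

Definition gaussian_mx (s : seq I) (h : I -> R) : 'M[R]_N :=
  \sum_(i <- s) (c i * h i) *: sym_delta (a i) (b i).

Lemma gaussian_mx_sym s h : (gaussian_mx s h)^T = gaussian_mx s h.
Proof.
by rewrite linear_sum /=; apply: eq_bigr => i _; rewrite linearZ /= sym_deltaT.
Qed.

(** Division by [(\tr W)^2] makes the expectation bounded by a constant, so no second moment of the
    trace is needed. *)
Let ratio (s : seq I) (h : I -> R) : R :=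
  \tr (W h *m gaussian_mx s h *m W h *m gaussian_mx s h) / (\tr (W h)) ^+ 2.

Let diag_ratio (i : I) (h : I -> R) : R :=
  c i ^+ 2 * \tr (W h *m sym_delta (a i) (b i) *m W h *m sym_delta (a i) (b i)) /
  (\tr (W h)) ^+ 2.

Let ratio_ge0 s h : 0 <= ratio s h.
Proof. by rewrite divr_ge0 ?sqr_ge0// W_ge0// gaussian_mx_sym. Qed.

Let diag_ratio_ge0 i h : 0 <= diag_ratio i h.
Proof. by rewrite divr_ge0 ?sqr_ge0// mulr_ge0 ?sqr_ge0// W_ge0. Qed.

Let mtr (M : #|I|.-tuple R -> 'M[R]_N) : measurable_mx M ->
  measurable_fun setT (fun y => \tr (M y)).
Proof. by move=> mM; apply: measurable_sum => i; exact: mM. Qed.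

Let mWt : measurable_mx (W \o of_tuple).
Proof. by move=> i j; exact: mW. Qed.

Let measurable_ratio s : coord_measurable (ratio s).
Proof.
have mK : measurable_mx (fun y : #|I|.-tuple R => gaussian_mx s (of_tuple y)).
  move=> p q; under eq_fun do rewrite /gaussian_mx summxE; apply: measurable_sum => i.
  under eq_fun do rewrite mxE; apply: measurable_funM => //; apply: measurable_funM => //.
  exact: coord_measurable_proj.
apply: measurable_funM.
  by apply: mtr; do 3! apply: measurable_mulmx => //.
by apply: measurable_inv; apply: measurable_funX; exact: mtr.
Qed.

Let measurable_diag_ratio i : coord_measurable (diag_ratio i).
Proof.
apply: measurable_funM; last by apply: measurable_inv; apply: measurable_funX; exact: mtr.
apply: measurable_funM => //; apply: mtr.
by do 3! apply: measurable_mulmx => //; exact: measurable_cstmx.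
Qed.

(** The Gaussians of [s] are integrated one at a time. [W] does not depend on them, so the ratio is
    a nonnegative quadratic polynomial in each, and [gaussian_quadratic_le] removes the cross terms
    at the price of 16 pi per variance. *)
Lemma gaussian_quadratic_expectation (s : seq I) (e : R) : uniq s ->
  (forall h i x, i \in s -> W (upd h i x) = W h) ->
  (forall h, \sum_(i <- s) c i ^+ 2 * (W h (a i) (a i) * W h (b i) (b i)) <=
     e * (\tr (W h)) ^+ 2) ->
  (forall h p q, W h p q ^+ 2 <= W h p p * W h q q) ->
  (\int[P]_t (\tr (W (g^~ t) *m gaussian_mx s (g^~ t) *m W (g^~ t) *m gaussian_mx s (g^~ t))
     / (\tr (W (g^~ t))) ^+ 2)%:E <= (64 * pi * e)%:E)%E.
Proof.
move=> us Ws We Woff.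
have step : (\int[P]_t (ratio s (g^~ t))%:E <=
    \int[P]_t (16 * pi * \sum_(i <- s) diag_ratio i (g^~ t))%:E)%E.
  elim: s us Ws {We} => [_ _|i s IH /= /andP[is_ us] Ws].
    rewrite le_eqVlt; apply/orP; left; apply/eqP; apply: eq_integral => t _.
    by rewrite big_nil mulr0 /ratio /gaussian_mx big_nil mulmx0 mxtrace0 mul0r.
  have mD : coord_measurable (fun h => 16 * pi * diag_ratio i h).
    by apply: measurable_funM => //; exact: measurable_diag_ratio.
  have pi16 : 0 <= 16 * pi :> R by rewrite mulr_ge0// pi_ge0.
  apply: (@le_trans _ _ (\int[P]_t (ratio s (g^~ t) + 16 * pi * diag_ratio i (g^~ t))%:E)%E).
    apply: (resample_le gauss_g indep_g (F := ratio (i :: s))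
      (F' := fun h => ratio s h + 16 * pi * diag_ratio i h) (i := i)) => //.
      by apply: measurable_funD => //; exact: measurable_ratio.
    move=> h; set M := W h; set K := gaussian_mx s h; set D := sym_delta (a i) (b i).
    pose B := c i * (\tr (M *m K *m M *m D) + \tr (M *m D *m M *m K)) / (\tr M) ^+ 2.
    (* Since [s] has no repetition, the remaining sum does not see coordinate [i]. *)
    have quad x : ratio (i :: s) (upd h i x) = ratio s h + B * x + diag_ratio i h * x ^+ 2.
      have -> : ratio (i :: s) (upd h i x) =
          \tr (M *m ((c i * x) *: D + K) *m M *m ((c i * x) *: D + K)) / (\tr M) ^+ 2.
        rewrite /ratio Ws ?mem_head//; congr (\tr (_ *m _ *m _ *m _) / _);
        rewrite /gaussian_mx big_cons /upd eqxx; congr (_ + _);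
        rewrite big_seq_cond [RHS]big_seq_cond; apply: eq_bigr => j; rewrite andbT => js;
        by case: eqVneq js is_ => // -> ->.
      rewrite tr_quadratic /ratio /B /diag_ratio -/M -/K -/D.
      by field; rewrite gt_eqF// trW_gt0.
    under eq_integral => x _ do rewrite quad.
    have := @gaussian_quadratic_le R _ B _ (ratio_ge0 s h) (diag_ratio_ge0 i h).
    by apply => x; rewrite -quad.
  have mR : measurable_fun [set: T] (fun t => (ratio s (g^~ t))%:E).
    by apply/measurable_EFinP; exact: (coord_measurable_comp gauss_g (measurable_ratio s)).
  have mDt j : measurable_fun [set: T] (fun t => diag_ratio j (g^~ t)).
    exact: (coord_measurable_comp gauss_g (measurable_diag_ratio j)).
  have mDi : measurable_fun [set: T] (fun t => (16 * pi * diag_ratio i (g^~ t))%:E).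
    by apply/measurable_EFinP; apply: measurable_funM.
  have mDs : measurable_fun [set: T]
      (fun t => (16 * pi * \sum_(j <- s) diag_ratio j (g^~ t))%:E).
    by apply/measurable_EFinP; apply: measurable_funM => //; exact: measurable_sum.
  have sum0 t : 0 <= \sum_(j <- s) diag_ratio j (g^~ t) by exact: sumr_ge0.
  under eq_integral do rewrite EFinD.
  under [leRHS]eq_integral do rewrite big_cons mulrDr EFinD.
  have D0 t : (0 <= (16 * pi * diag_ratio i (g^~ t))%:E)%E.
    by rewrite lee_fin; exact: mulr_ge0.
  have Ds0 t : (0 <= (16 * pi * \sum_(j <- s) diag_ratio j (g^~ t))%:E)%E.
    by rewrite lee_fin; exact: mulr_ge0.
  have R0 t : (0 <= (ratio s (g^~ t))%:E)%E by rewrite lee_fin; exact: ratio_ge0.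
  rewrite !ge0_integralD// [leRHS]addeC leeD2r//; apply: IH => // h j x js.
  by apply: Ws; rewrite inE js orbT.
apply: (le_trans step); apply: (@le_trans _ _ (\int[P]_t (64 * pi * e)%:E)%E); last first.
  by rewrite integral_cst//= probability_setT mule1.
apply: ge0_le_integral => //.
- move=> t _; rewrite lee_fin mulr_ge0//; first by rewrite mulr_ge0// pi_ge0.
  exact: sumr_ge0.
- apply/measurable_EFinP; apply: measurable_funM => //; apply: measurable_sum => i.
  exact: (coord_measurable_comp gauss_g (measurable_diag_ratio i)).
- move=> t _; rewrite lee_fin.
  (* The 4 comes from [tr_sym_delta]: positivity of [W] bounds 2 W_aa W_bb + 2 W_ab^2 by 4 W_aa
     W_bb. *)
  have -> : 64 * pi * e = 16 * pi * (4 * e) by ring.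
  apply: ler_wpM2l; first by rewrite mulr_ge0// pi_ge0.
  have tr2 : 0 < (\tr (W (g^~ t))) ^+ 2 by rewrite exprn_gt0.
  rewrite -mulr_suml ler_pdivrMr// -mulrA.
  apply: le_trans (ler_wpM2l _ (We (g^~ t))); last by [].
  rewrite mulr_sumr; apply: ler_sum => i _; rewrite tr_sym_delta// [leRHS]mulrCA.
  apply: ler_wpM2l; first exact: sqr_ge0.
  have := Woff (g^~ t) (a i) (b i); lra.
Qed.

End QuadraticExpectation.

(** * Deterministic bounds on the window *)

Section WindowBound.
Context {R : realType} {N : nat}.
Implicit Types (A H U V : 'M[R]_N) (E eta : R).

Lemma eigenbasis_spectral H U (lam : 'I_N -> R) : eigenbasis H U lam ->
  U^T *m U = 1%:M /\ H = U *m diag_mx (\row_k lam k) *m U^T.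
Proof.
by move=> [UU HU]; split=> //; rewrite -HU -mulmxA orthoC ?mulmx1.
Qed.

(* Cauchy-Schwarz over the pairs (y,k), the window indicator being dominated by
   2 eta^2 / ((lam - E)^2 + eta^2). *)
Lemma correlator_sum_le H U (lam : 'I_N -> R) E eta (x : 'I_N) (Y : pred 'I_N) :
  eigenbasis H U lam -> 0 < eta ->
  (\sum_(y | Y y) Qcorr U lam (E - eta) (E + eta) x y) ^+ 2 <=
  4 * N%:R * eta ^+ 4 * \tr (sqres H E eta) * sqres H E eta x x.
Proof.
move=> UlH eta0; have etaN0 : eta != 0 by rewrite gt_eqF.
have [UU HE] := eigenbasis_spectral UlH.
pose W k := lam k \in `[E - eta, E + eta].
pose lor k := ((lam k - E) ^+ 2 + eta ^+ 2)^-1.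
have lor0 k : 0 <= lor k by rewrite invr_ge0 ltW// lorentz_den_gt0.
have WL k : W k -> 1 <= 2 * eta ^+ 2 * lor k.
  rewrite /W in_itv /= => /andP[k1 k2].
  rewrite ler_pdivlMr ?mul1r ?lorentz_den_gt0//.
  have : 0 <= (eta - (lam k - E)) * (eta + (lam k - E)) by apply: mulr_ge0; lra.
  nra.
have entryE z : sqres H E eta z z = \sum_k U z k ^+ 2 * lor k.
  by rewrite (sqres_diagE E z UU etaN0 HE); apply: eq_bigr => k _; rewrite mxE.
have window z : \sum_(k | W k) U z k ^+ 2 <= 2 * eta ^+ 2 * sqres H E eta z z.
  rewrite entryE mulr_sumr big_mkcond /=; apply: ler_sum => k _.
  have t0 : 0 <= U z k ^+ 2 * lor k by rewrite mulr_ge0// sqr_ge0.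
  case: ifP => [/WL Wk|_]; last by rewrite mulr_ge0// mulr_ge0// sqr_ge0.
  by rewrite mulrCA -[leLHS]mulr1 ler_wpM2l// sqr_ge0.
pose X (p : 'I_N * 'I_N) := if W p.2 then `|U x p.2| else 0.
pose Z (p : 'I_N * 'I_N) := if W p.2 then `|U p.1 p.2| else 0.
have sum_le : \sum_(y | Y y) Qcorr U lam (E - eta) (E + eta) x y <= \sum_p X p * Z p.
  rewrite -(pair_bigA _ (fun y k => X (y, k) * Z (y, k))) /=.
  rewrite big_mkcond; apply: ler_sum => y _.
  have q0 : 0 <= \sum_k X (y, k) * Z (y, k).
    by apply: sumr_ge0 => k _; rewrite /X /Z; case: ifP => _; rewrite ?mulr0// mulr_ge0.
  case: ifP => // _; rewrite /Qcorr big_mkcond; apply: ler_sum => k _.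
  by rewrite /X /Z /W /=; case: ifP => _; rewrite ?normrM ?mulr0.
have sum0 : 0 <= \sum_(y | Y y) Qcorr U lam (E - eta) (E + eta) x y.
  by apply: sumr_ge0 => y _; apply: sumr_ge0.
apply: (@le_trans _ _ ((\sum_p X p * Z p) ^+ 2)).
  by rewrite ler_sqr ?nnegrE// (le_trans sum0).
have := @weighted_cauchy_schwarz R _ (fun=> 1) X Z (fun=> ltr01).
move=> /le_trans; apply.
under eq_bigr do rewrite mulr1; under [X in _ * X]eq_bigr do rewrite divr1.
have XE : \sum_p X p ^+ 2 <= N%:R * (2 * eta ^+ 2 * sqres H E eta x x).
  rewrite -(pair_bigA _ (fun y k => X (y, k) ^+ 2)) /= -[N in N%:R]card_ord -sum1_card.
  rewrite natr_sum mulr_suml; apply: ler_sum => y _; rewrite mul1r.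
  apply: le_trans (window x); rewrite [leRHS]big_mkcond /=; apply: ler_sum => k _.
  by rewrite /X /=; case: ifP => _; rewrite ?real_normK ?num_real ?expr0n.
have ZE : \sum_p Z p ^+ 2 <= 2 * eta ^+ 2 * \tr (sqres H E eta).
  rewrite -(pair_bigA _ (fun y k => Z (y, k) ^+ 2)) /= mulr_sumr; apply: ler_sum => y _.
  apply: le_trans (window y); rewrite [leRHS]big_mkcond /=; apply: ler_sum => k _.
  by rewrite /Z /=; case: ifP => _; rewrite ?real_normK ?num_real ?expr0n.
have X0 : 0 <= \sum_p X p ^+ 2 by apply: sumr_ge0 => p _; exact: sqr_ge0.
have Z0 : 0 <= \sum_p Z p ^+ 2 by apply: sumr_ge0 => p _; exact: sqr_ge0.
apply: (le_trans (ler_pM X0 Z0 XE ZE)).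
by rewrite le_eqVlt; apply/orP; left; apply/eqP; ring.
Qed.

(* If the local density of states of a diagonal block at scale eta' is below the
   contribution of a single eigenvalue, the block has no eigenvalue within eta'
   of E and smaller scales are not resolved. *)
Lemma sqres_block_gap A (B : pred 'I_N) E eta eta' x : A^T = A ->
  (forall y z, B y != B z -> A y z = 0) -> B x -> eta != 0 -> 0 < eta' ->
  eta' ^+ 2 * \sum_(z | B z) sqres A E eta' z z <= 2^-1 ->
  sqres A E eta x x <= 2 * sqres A E eta' x x.
Proof.
move=> symA blockA Bx eta0 eta'0 trB; have eta'N0 : eta' != 0 by rewrite gt_eqF.
have [V [l [VV AE]]] := symmetric_spectral symA; have VV' := orthoC VV.
pose p : 'M[R]_N := diag_mx (\row_z (B z)%:R).
have pA : p *m A = A *m p.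
  apply/matrixP => y z; rewrite mul_diag_mx mul_mx_diag !mxE.
  have [->|/blockA ->] := eqVneq (B y) (B z); last by rewrite mulr0 mul0r.
  by rewrite mulrC.
have pp : p *m p = p.
  apply/matrixP => y z; rewrite mul_diag_mx !mxE; case: (B y) => /=.
    by rewrite mul1r.
  by rewrite mul0r mul0rn.
(* The projection onto the block, written in the eigenbasis of [A]. With degenerate eigenvalues the
   chosen eigenvectors need not be supported in one block, so [G] need not be diagonal; commutation
   with [A] makes it vanish between distinct eigenvalues. *)
pose G := V^T *m p *m V.
have GE i j : G i j = \sum_(z | B z) V z i * V z j.
  rewrite /G -mulmxA mxE [RHS]big_mkcond; apply: eq_bigr => z _.
  by rewrite mul_diag_mx !mxE; case: (B z); rewrite ?mul1r// mul0r mulr0.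
have Gsym i j : G i j = G j i by rewrite !GE; apply: eq_bigr => z _; rewrite mulrC.
have Gl i j : G i j != 0 -> l 0 i = l 0 j.
  have AV : V^T *m A = diag_mx l *m V^T by rewrite AE !mulmxA VV mul1mx.
  have VA : A *m V = V *m diag_mx l by rewrite AE -!mulmxA VV mulmx1.
  have GD : V^T *m (p *m A) *m V = G *m diag_mx l.
    by rewrite /G -!mulmxA VA !mulmxA.
  have DG : V^T *m (A *m p) *m V = diag_mx l *m G by rewrite /G !mulmxA AV.
  have : G *m diag_mx l = diag_mx l *m G by rewrite -GD -DG pA.
  move/matrixP/(_ i j); rewrite mul_mx_diag mul_diag_mx.
  move: (G) => M; rewrite !mxE => e Mij.
  by apply: (mulfI Mij); rewrite e mulrC.
have GG j : G j j = \sum_i G i j ^+ 2.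
  have : G = G *m G by rewrite /G !mulmxA -(mulmxA _ V V^T) VV' mulmx1 -(mulmxA _ p p) pp.
  move/matrixP/(_ j j); rewrite [in RHS]mxE => ->.
  by apply: eq_bigr => i _; rewrite (Gsym j i) expr2.
pose w j := ((l 0 j - E) ^+ 2 + eta' ^+ 2)^-1.
have w0 j : 0 < w j by rewrite invr_gt0 lorentz_den_gt0.
have trBE : \sum_(z | B z) sqres A E eta' z z = \sum_i w i * G i i.
  under eq_bigr do rewrite (sqres_diagE E _ VV eta'N0 AE).
  rewrite exchange_big; apply: eq_bigr => i _; rewrite GE mulr_sumr.
  by apply: eq_bigr => z _; rewrite mulrC expr2.
have GCS i j : G i j ^+ 2 <= G i i * G j j.
  rewrite !GE !(big_mkcond B) /=.
  pose b k z := if B z then V z k else 0.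
  have bE k k' z : (if B z then V z k * V z k' else 0) = b k z * b k' z.
    by rewrite /b; case: ifP; rewrite ?mulr0.
  under eq_bigr do rewrite bE; under [X in _ <= X * _]eq_bigr do rewrite bE.
  under [X in _ <= _ * X]eq_bigr do rewrite bE.
  have := @weighted_cauchy_schwarz R _ (fun=> 1) (b i) (b j) (fun=> ltr01).
  move=> /le_trans; apply; rewrite le_eqVlt; apply/orP; left; apply/eqP.
  by congr (_ * _); apply: eq_bigr => z _; rewrite ?mulr1 ?divr1 expr2.
(* From G = G^2, w_j G_jj is the sum over i of w_j G_ij^2. There w_j may be replaced by w_i, and
   G_ij^2 <= G_ii G_jj. Dividing by G_jj > 0 shows that w_j is at most the local trace on the
   block. *)
have gap j : V x j != 0 -> eta' ^+ 2 <= (l 0 j - E) ^+ 2.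
  move=> Vxj.
  have Gjj : 0 < G j j.
    rewrite GE (bigD1 x)//= ltr_pwDl// -?expr2 ?exprn_even_gt0//.
    by apply: sumr_ge0 => z _; rewrite -expr2 sqr_ge0.
  have : w j * G j j <= (\sum_i w i * G i i) * G j j.
    rewrite {1}GG mulr_sumr mulr_suml; apply: ler_sum => i _.
    have [->|/Gl lij] := eqVneq (G i j) 0.
      have : 0 <= G i i by rewrite GG; apply: sumr_ge0 => k _; exact: sqr_ge0.
      by move=> Gii; rewrite expr0n mulr0 !mulr_ge0// ltW.
    have -> : w j = w i by rewrite /w lij.
    by rewrite -mulrA ler_wpM2l// ltW.
  rewrite ler_pM2r// -trBE => wj.
  have : eta' ^+ 2 * w j <= 2^-1.
    by apply: le_trans trB; rewrite ler_wpM2l// sqr_ge0.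
  rewrite /w ler_pdivrMr ?lorentz_den_gt0//; lra.
rewrite (sqres_diagE E x VV eta0 AE) (sqres_diagE E x VV eta'N0 AE) mulr_sumr.
apply: ler_sum => j _.
have [->|/gap hj] := eqVneq (V x j) 0; first by rewrite expr0n !mul0r mulr0.
(* Beyond distance eta' the two denominators compare: (l - E)^2 + eta'^2 <= 2 (l - E)^2. *)
rewrite mulrCA ler_wpM2l ?sqr_ge0//.
rewrite -[leLHS]mul1r ler_pdivrMr ?lorentz_den_gt0// mulrAC ler_pdivlMr ?lorentz_den_gt0//.
have := sqr_ge0 eta; lra.
Qed.

End WindowBound.

(** * The ultrametric ensemble *)

Section Ultrametric.
Local Open Scope nat_scope.

(** The partitions are nested, so sharing a block persists at all coarser levels. *)
Lemma udist_le m x y : (udist x y <= m)%N = (x %/ 2 ^ m == y %/ 2 ^ m).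
Proof.
have mono r r' : (r <= r')%N -> x %/ 2 ^ r == y %/ 2 ^ r -> x %/ 2 ^ r' == y %/ 2 ^ r'.
  by move=> /subnKC <- /eqP e; rewrite expnD !divnMA e.
rewrite /udist; case: ex_minnP => k same_k min_k.
by apply/idP/idP => [km|/min_k//]; exact: mono km same_k.
Qed.

Lemma udist_sym x y : udist x y = udist y x.
Proof.
by apply/eqP; rewrite eqn_leq !udist_le; apply/andP; split;
  rewrite eq_sym -udist_le.
Qed.

Lemma udistxx x : udist x x = 0%N.
Proof. by apply/eqP; rewrite -leqn0 udist_le. Qed.

Lemma card_block n m (x : nat) : (#|[pred z : 'I_(2 ^ n) | (udist x z <= m)%N]| <= 2 ^ m)%N.
Proof.
have m0 : (0 < 2 ^ m)%N by rewrite expn_gt0.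
pose f (z : 'I_(2 ^ n)) : 'I_(2 ^ m) := Ordinal (ltn_pmod z m0).
rewrite -[leqRHS]card_ord -(@card_in_imset _ _ f) ?max_card// => y z.
rewrite !inE !udist_le => /eqP xy /eqP xz [yz]; apply/val_inj => /=.
by rewrite (divn_eq y (2 ^ m)) (divn_eq z (2 ^ m)) -xy -xz yz.
Qed.

End Ultrametric.

Section Model.
Context {R : realType} (n : nat) (c Z : R).
Local Notation N := (2 ^ n)%N.
Hypothesis hc : 0 < c.
Hypothesis normZ : is_normalization n c Z.

(** The ensemble as a deterministic function of the Gaussian family, the form needed for resampling;
    the sample space is instantiated with [unit]. *)
Definition ultra_mx (h : gidx n -> R) : 'M[R]_N :=
  Hmat c Z (fun i (_ : unit) => h i) tt.

Definition coupling (r : nat) (x y : 'I_N) : R :=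
  Z^-1 * (2 `^ (- ((1 + c) * r%:R / 2)) * Num.sqrt (phi_var r x y)).

Let lo (x y : 'I_N) := if (x <= y)%N then x else y.
Let hi (x y : 'I_N) := if (x <= y)%N then y else x.

Lemma ultra_mxE h x y :
  ultra_mx h x y = \sum_(r < n.+1) coupling r x y * h (r, lo x y, hi x y).
Proof.
rewrite mxE mulr_sumr; apply: eq_bigr => r _.
by rewrite /Phi /coupling !mulrA.
Qed.

Lemma phi_var_sym r (x y : 'I_N) : phi_var r x y = phi_var r y x :> R.
Proof. by rewrite /phi_var eq_sym udist_sym. Qed.

Lemma coupling_sym r x y : coupling r x y = coupling r y x.
Proof. by rewrite /coupling phi_var_sym. Qed.

Let lo_sym x y : lo x y = lo y x.
Proof. by rewrite /lo; case: ltngtP => // /val_inj. Qed.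

Let hi_sym x y : hi x y = hi y x.
Proof. by rewrite /hi; case: ltngtP => // /val_inj. Qed.

Lemma ultra_mx_sym h : (ultra_mx h)^T = ultra_mx h.
Proof.
apply/matrixP => x y; rewrite mxE !ultra_mxE; apply: eq_bigr => r _.
by rewrite coupling_sym lo_sym hi_sym.
Qed.

Lemma measurable_ultra_mx : coord_measurable_mx ultra_mx.
Proof.
move=> x y; rewrite /coord_measurable.
rewrite (_ : _ \o _ = fun u => \sum_(r < n.+1)
    coupling r x y * of_tuple u (r, lo x y, hi x y)).
  apply: measurable_sum => r; apply: measurable_funM => //.
  exact: coord_measurable_proj.
by apply/funext => u /=; rewrite ultra_mxE.
Qed.

(** The coefficient of the level-0 Gaussian in a diagonal entry. Wegner resamples this level only;
    the higher levels remain frozen in the matrix. *)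
Definition diag_coupling : R := Num.sqrt 2 / Z.

Let Z0 : 0 < Z. Proof. by have [] := normZ. Qed.

Lemma diag_coupling_gt0 : 0 < diag_coupling.
Proof. by rewrite divr_gt0// sqrtr_gt0. Qed.

Let coupling_diag z : coupling 0 z z = diag_coupling.
Proof.
rewrite /coupling /phi_var eqxx mulr0 mul0r oppr0 powRr0 mul1r mul1r.
by rewrite /diag_coupling mulrC.
Qed.

Variable B : pred 'I_N.

Definition block_mx_of (h : gidx n -> R) : 'M[R]_N :=
  \matrix_(x, y) if B x == B y then ultra_mx h x y else 0.

(** The strict inequality keeps one representative of each unordered pair, since entries read the
    Gaussians at (min, max). *)
Definition cross_indices : seq (gidx n) :=
  [seq i : 'I_n.+1 * 'I_N * 'I_N <- enum {: gidx n} | (i.1.2 < i.2)%N && (B i.1.2 != B i.2)].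

Definition index_coupling (i : gidx n) : R := coupling i.1.1 i.1.2 i.2.

Lemma block_mx_ofE h x y :
  block_mx_of h x y = if B x == B y then ultra_mx h x y else 0.
Proof. by rewrite mxE. Qed.

Lemma block_mx_of_sym h : (block_mx_of h)^T = block_mx_of h.
Proof.
apply/matrixP => x y; rewrite mxE !block_mx_ofE eq_sym; case: ifP => // _.
by rewrite -[in LHS]ultra_mx_sym [LHS]mxE.
Qed.

Lemma measurable_block_mx_of : coord_measurable_mx block_mx_of.
Proof.
move=> x y; rewrite /coord_measurable.
rewrite (_ : _ \o _ = fun u => if B x == B y then (ultra_mx (of_tuple u)) x y else 0).
  by case: (B x == B y); [exact: measurable_ultra_mx|exact: measurable_cst].
by apply/funext => u /=; rewrite block_mx_ofE.
Qed.

Lemma ultra_mx_upd_diag h z x :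
  ultra_mx (upd h (ord0, z, z) x) =
  ultra_mx (upd h (ord0, z, z) 0) + (diag_coupling * x) *: delta_mx z z.
Proof.
apply/matrixP => y y'; rewrite [RHS]mxE !ultra_mxE [X in _ = _ + X]mxE [delta_mx _ _ _ _]mxE.
rewrite (bigD1 ord0)//= [X in _ = X + _](bigD1 ord0)//= addrAC; congr (_ + _); last first.
  by apply: eq_bigr => r r0; rewrite /upd !xpair_eqE (negbTE r0).
have lohiE : (lo y y' == z) && (hi y y' == z) = (y == z) && (y' == z).
  by rewrite /lo /hi; case: (y <= y')%N; rewrite // andbC.
rewrite /upd !xpair_eqE eqxx /= lohiE; case: ifP => [/andP[/eqP -> /eqP ->]|_].
  by rewrite /= mulr0 add0r mulr1 coupling_diag.
by rewrite mulr0 addr0.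
Qed.

Lemma block_mx_of_upd_diag h z x :
  block_mx_of (upd h (ord0, z, z) x) =
  block_mx_of (upd h (ord0, z, z) 0) + (diag_coupling * x) *: delta_mx z z.
Proof.
apply/matrixP => y y'; rewrite [RHS]mxE !block_mx_ofE ultra_mx_upd_diag.
case: ifP => [_|/negbT BB]; first by rewrite [LHS]mxE.
rewrite add0r [RHS]mxE mxE; case: (eqVneq y z) => [yz|_]; last by rewrite mulr0.
case: (eqVneq y' z) => [y'z|_]; last by rewrite mulr0.
by move: BB; rewrite yz y'z eqxx.
Qed.

Lemma block_mx_of_upd_cross h i x : i \in cross_indices ->
  block_mx_of (upd h i x) = block_mx_of h.
Proof.
rewrite mem_filter => /andP[/andP[_ Bi] _]; apply/matrixP => y y'; rewrite !block_mx_ofE.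
case: ifP => // /eqP BB; rewrite !ultra_mxE; apply: eq_bigr => r _; congr (_ * _).
rewrite /upd.
case: eqP => // e; move: Bi; rewrite -e /= /lo /hi.
by case: (y <= y')%N; rewrite BB eqxx.
Qed.

Lemma ultra_mx_split h :
  ultra_mx h = block_mx_of h +
    gaussian_mx index_coupling (fun i => i.1.2) (fun i => i.2) cross_indices h.
Proof.
apply/matrixP => y y'; rewrite [RHS]mxE block_mx_ofE /gaussian_mx summxE.
pose F (i : gidx n) := index_coupling i * h i *
   ((y == i.1.2) && (y' == i.2))%:R + index_coupling i * h i * ((y == i.2) && (y' == i.1.2))%:R.
under [X in _ = _ + X]eq_bigr do rewrite !mxE mulrDr -/(F _).
rewrite big_filter big_enum_cond /=.
have crossP i : F i != 0 -> (i.1.2 < i.2)%N -> B i.1.2 != B i.2 ->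
  [/\ i.1.2 = lo y y', i.2 = hi y y' & B y != B y'].
  move=> Fi lt BB; have [/andP[/eqP e1 /eqP e2]|h1] := boolP ((y == i.1.2) && (y' == i.2)).
    by rewrite /lo /hi e1 e2 (ltnW lt).
  have [/andP[/eqP e1 /eqP e2]|h2] := boolP ((y == i.2) && (y' == i.1.2)).
    by rewrite /lo /hi e1 e2 leqNgt lt eq_sym.
  by move: Fi; rewrite /F (negbTE h1) (negbTE h2) !mulr0 addr0 eqxx.
case: ifP => [/eqP BB|/negbT BB].
  rewrite big1 ?addr0// => i /andP[lt Bi]; apply/eqP; apply/negPn/negP => Fi.
  by have [_ _] := crossP i Fi lt Bi; rewrite BB eqxx.
rewrite add0r ultra_mxE.
have yy' : y != y' by apply: contraNneq BB => ->.
have lohi : (lo y y' < hi y y')%N.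
  rewrite /lo /hi; case: (leqP y y') => //; rewrite leq_eqVlt => /orP[/eqP e|//].
  by move: yy'; rewrite (val_inj e) eqxx.
have Blohi : B (lo y y') != B (hi y y').
  by rewrite /lo /hi; case: ifP => _ //; rewrite eq_sym.
transitivity (\sum_(r < n.+1) F (r, lo y y', hi y y')).
  apply: eq_bigr => r _; rewrite /F /index_coupling /=.
  move: lohi; rewrite /lo /hi; case: ifP => _ lt.
    by rewrite !eqxx (negbTE yy') /= mulr1 mulr0 addr0.
  by rewrite !eqxx (negbTE yy') /= mulr1 mulr0 add0r coupling_sym.
pose L := lo y y'; pose H := hi y y'.
transitivity (\sum_(i : gidx n | (i.1.2 == L) && (i.2 == H)) F i).
  rewrite (reindex_onto (fun r => (r, L, H)) (fun i => i.1.1)) /=.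
    by apply: eq_bigl => r; rewrite !eqxx.
  by move=> [[r a] b] /= /andP[/eqP -> /eqP ->].
rewrite big_mkcond [RHS]big_mkcond; apply: eq_bigr => i _ /=.
case: ifP => [/andP[/eqP iL /eqP iH]|].
  by rewrite iL iH lohi Blohi.
case: ifP => // /andP[lt Bi] /negbT neq; apply/esym/eqP/negPn/negP => Fi.
by have [eL eH _] := crossP i Fi lt Bi; rewrite eL eH !eqxx in neq.
Qed.

End Model.

Section Couplings.
Context {R : realType} (n : nat) (c Z : R).
Local Notation N := (2 ^ n)%N.
Hypothesis hc : 0 < c.
Hypothesis normZ : is_normalization n c Z.

Lemma powR2_natN (r : nat) : 2 `^ (- r%:R) = 2 ^- r :> R.
Proof. by rewrite powRN powR_mulrn. Qed.

Lemma powR2_sqr (a : R) : (2 `^ (- (a / 2))) ^+ 2 = 2 `^ (- a).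
Proof.
rewrite expr2 -powRD; first by congr (_ `^ _); field.
by rewrite pnatr_eq0 implybT.
Qed.

Lemma phi_var_ge0 r (x y : nat) : 0 <= phi_var r x y :> R.
Proof.
rewrite /phi_var; case: ifP => _; first by rewrite mulr_ge0// powR_ge0.
by case: ifP => // _; exact: powR_ge0.
Qed.

Let x0 : 'I_N := Ordinal (expn_gt0 2 n : (0 < N)%N).

Lemma normalization_ge : 2 <= Z ^+ 2.
Proof.
have [_ /(_ x0) <-] := normZ.
rewrite (bigD1 x0)//= (bigD1 ord0)//= -addrA.
have -> : (2 `^ (- ((1 + c) * 0%:R / 2))) ^+ 2 * phi_var 0 x0 x0 = 2 :> R.
  by rewrite mulr0 mul0r oppr0 powRr0 expr1n mul1r /phi_var eqxx oppr0 powRr0 mul1r.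
rewrite lerDl addr_ge0//; first apply: sumr_ge0 => r _.
  by rewrite mulr_ge0 ?sqr_ge0 ?phi_var_ge0.
by apply: sumr_ge0 => y _; apply: sumr_ge0 => r _; rewrite mulr_ge0 ?sqr_ge0 ?phi_var_ge0.
Qed.

Let sum_phi_var r (x : 'I_N) : \sum_(y < N) phi_var r x y <= 3 :> R.
Proof.
have h : forall y : 'I_N, phi_var r x y <=
    (if y == x then 2 * 2 ^- r else 0) + (if (udist x y <= r)%N then 2 ^- r else 0) :> R.
  move=> y; rewrite /phi_var powR2_natN.
  have -> : (val x == val y) = (y == x) by rewrite eq_sym.
  have p0 : 0 <= 2 ^- r :> R by rewrite invr_ge0 exprn_ge0.
  case: ifP => [_|_]; first by rewrite mulrC lerDl; case: ifP.
  by rewrite add0r; case: ifP => [/andP[_ ->]//|_]; case: ifP.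
apply: (le_trans (ler_sum _ (fun y _ => h y))); rewrite big_split /=.
rewrite -!big_mkcond /= big_pred1_eq.
have r1 : 2 ^- r <= 1 :> R by rewrite invf_le1 ?exprn_gt0// exprn_ege1// ler1n.
have -> : 3 = 2 + 1 :> R by rewrite -natr1.
apply: lerD; first by rewrite -[leRHS]mulr1 ler_wpM2l.
rewrite sumr_const -[leLHS]mulr_natr ler_pdivrMl ?exprn_gt0// mulr1.
by rewrite -natrX ler_nat card_block.
Qed.

(** Level r contributes at most 3 * 2^-r: its row variance is at most 3 and its weight 2^(-(1+c)r)
    at most 2^-r. The geometric series then keeps the diagonal coupling above 1/2 uniformly in n. *)
Lemma normalization_le : Z ^+ 2 <= 6.
Proof.
have [_ /(_ x0) <-] := normZ; rewrite exchange_big /=.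
have geom (k : nat) : \sum_(r < k) 2 ^- r <= 2 - 2 * 2 ^- k :> R.
  elim: k => [|k IH]; first by rewrite big_ord0 expr0 invr1; lra.
  by rewrite big_ord_recr /= exprS invfM; lra.
apply: (@le_trans _ _ (\sum_(r < n.+1) 2 ^- r * 3)).
  apply: ler_sum => r _; rewrite -mulr_sumr; apply: ler_pM; [exact: sqr_ge0| | |exact: (sum_phi_var r x0)].
    by apply: sumr_ge0 => y _; exact: phi_var_ge0.
  rewrite powR2_sqr -powR2_natN; apply: ler_powR; first by rewrite ler1n.
  by rewrite lerN2 mulrDl mul1r lerDl mulr_ge0// ltW.
rewrite -mulr_suml; have := geom n.+1.
have : 0 <= 2 ^- n.+1 :> R by rewrite invr_ge0 exprn_ge0.
lra.
Qed.

Lemma diag_coupling_ge : 2^-1 <= diag_coupling Z.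
Proof.
have [Z0 _] := normZ; rewrite /diag_coupling ler_pdivlMr//.
rewrite -ler_sqr ?nnegrE ?mulr_ge0 ?sqrtr_ge0 ?(ltW Z0)// sqr_sqrtr//.
by have := normalization_le; lra.
Qed.

(** Only levels r >= [udist x y] > m couple the two points, and level r contributes 2^(-(1+c)r)
    times the entry variance 2^-r. *)
Lemma coupling_sqr_le r (x y : 'I_N) m : (m < udist x y)%N ->
  coupling c Z r x y ^+ 2 <= 2 `^ (- ((2 + c) * m%:R)).
Proof.
move=> mxy; have [Z0 _] := normZ.
have Z2 := normalization_ge.
rewrite /coupling exprMn exprMn sqr_sqrtr ?phi_var_ge0// powR2_sqr.
rewrite /phi_var; case: eqP => [/val_inj xy|_].
  by move: mxy; rewrite xy udistxx.
case: ifP => [/andP[_ xyr]|_]; last by rewrite !mulr0 powR_ge0.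
rewrite -powRD; last by rewrite pnatr_eq0 implybT.
apply: (@le_trans _ _ (1 * 2 `^ (- ((1 + c) * r%:R) - r%:R))).
  rewrite ler_wpM2r ?powR_ge0// exprVn invf_le1 ?exprn_gt0//; lra.
rewrite mul1r; apply: ler_powR; first by rewrite ler1n.
have mr : m%:R <= r%:R :> R by rewrite ler_nat (leq_trans (ltnW mxy)).
have c0 : 0 <= c := ltW hc.
have : c * m%:R <= c * r%:R by rewrite ler_wpM2l.
lra.
Qed.

Lemma cross_coupling_sum_le (B : pred 'I_N) m (W : 'M[R]_N) :
  (forall x y, B x != B y -> (m < udist x y)%N) -> (forall x, 0 <= W x x) ->
  \sum_(i <- cross_indices B) index_coupling c Z i ^+ 2 * (W i.1.2 i.1.2 * W i.2 i.2) <=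
  n.+1%:R * 2 `^ (- ((2 + c) * m%:R)) * (\tr W) ^+ 2.
Proof.
move=> Bm W0; rewrite big_filter big_enum_cond /=.
pose e : R := 2 `^ (- ((2 + c) * m%:R)).
apply: (@le_trans _ _ (\sum_(i : gidx n) e * (W i.1.2 i.1.2 * W i.2 i.2))).
  rewrite big_mkcond /=; apply: ler_sum => -[[r x] y] _ /=.
  case: ifP => [/andP[_ BB]|_]; last by rewrite mulr_ge0 ?powR_ge0 ?mulr_ge0.
  by rewrite ler_wpM2r ?mulr_ge0// /index_coupling /= coupling_sqr_le// Bm.
rewrite le_eqVlt; apply/orP; left; apply/eqP.
rewrite -(pair_bigA _ (fun (p : 'I_n.+1 * 'I_N) y => e * (W p.2 p.2 * W y y))) /=.
rewrite -(pair_bigA _ (fun (r : 'I_n.+1) x => \sum_y e * (W x x * W y y))) /=.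
rewrite sumr_const card_ord -[LHS]mulr_natl -[RHS]mulrA; congr (_ * _).
rewrite expr2 /mxtrace mulr_suml mulr_sumr; apply: eq_bigr => x _.
by rewrite mulr_sumr mulr_sumr.
Qed.

End Couplings.

(** * Tail probability at fixed scales *)

Section Expectations.
Context {R : realType} {d : measure_display} {T : measurableType d} (P : probability T R).

Lemma markov_bound (X : T -> R) (M a : R) : measurable_fun setT X ->
  (forall t, 0 <= X t) -> 0 < a -> 0 < M ->
  (\int[P]_t (X t)%:E <= M%:E)%E ->
  measurable [set t | a * M <= X t] /\ (P [set t | (a * M <= X t)%R] <= (a^-1)%:E)%E.
Proof.
move=> mX X0 a0 M0 XM.
have mS : measurable [set t | a * M <= X t].
  rewrite (_ : [set t | _] = setT `&` X @^-1` `[a * M, +oo[); first exact: mX.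
  by apply/seteqP; split=> t /=; rewrite in_itv /= andbT; [|case].
split=> //.
have aM : (0 < a * M) by rewrite mulr_gt0.
have : ((a * M)%:E * P [set t | (a * M <= X t)%R] <= M%:E)%E.
  apply: le_trans XM.
  have mEX : measurable_fun setT (fun t => (X t)%:E) by exact/measurable_EFinP.
  apply: (@le_trans _ _ (\int[P]_(t in [set t | (a * M <= X t)%R]) (X t)%:E)%E).
    rewrite -integral_cst//; apply: ge0_le_integral => //.
    + by move=> t _; rewrite lee_fin ltW.
    + exact: measurable_funTS.
  by apply: ge0_subset_integral => // t _; rewrite lee_fin.
rewrite -lee_pdivlMl// => /le_trans; apply; rewrite -EFinM lee_fin invfM -mulrA mulVf ?gt_eqF//.
by rewrite mulr1.
Qed.

Lemma expectation_sum_le (J : finType) (Q : pred J) (f : J -> T -> R) (C : R) :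
  (forall z, measurable_fun setT (f z)) -> (forall z t, 0 <= f z t) ->
  (forall z, \int[P]_t (f z t)%:E <= C%:E)%E ->
  (\int[P]_t (\sum_(z | Q z) f z t)%:E <= (#|Q|%:R * C)%:E)%E.
Proof.
move=> mf f0 fC.
have -> : (fun t => (\sum_(z | Q z) f z t)%:E) =
    (fun t => \sum_(z <- enum Q) (f z t)%:E)%E.
  by apply/funext => t; rewrite sumEFin big_enum.
rewrite ge0_integral_sum//; last 2 first.
- by move=> z; exact/measurable_EFinP.
- by move=> z t _; rewrite lee_fin.
apply: (@le_trans _ _ (\sum_(z <- enum Q) C%:E)%E); first exact: lee_sum.
by rewrite sumEFin big_enum sumr_const mulr_natl.
Qed.

End Expectations.

Section TailProbability.
Context {R : realType} (n m : nat) (c Z E eta eta' a s : R).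
Local Notation N := (2 ^ n)%N.
Context {d : measure_display} {T : measurableType d} (P : probability T R).
Variable g : gidx n -> T -> R.
Hypothesis hc : 0 < c.
Hypothesis normZ : is_normalization n c Z.
Hypothesis gauss_g : forall i, std_gaussian P (g i).
Hypothesis indep_g : mutually_independent P g.
Variable x : 'I_N.

Let B : pred 'I_N := fun z => (udist x z <= m)%N.
Let H (h : gidx n -> R) : 'M[R]_N := ultra_mx c Z h.
Let H0 (h : gidx n -> R) : 'M[R]_N := block_mx_of c Z B h.
Let W (h : gidx n -> R) : 'M[R]_N := abs_resolvent n (H0 h) E.

(** [C0] is the Wegner constant pi / v with v >= 1/2, [D] the resulting bound on the mean of
    [W z z], and [e] the size of the couplings in [K] summed over levels. [tau] is the bound on 16
    Tr(W K W K) that holds off the bad events for [X2] and [X4] below. *)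
Let C0 : R := 2 * pi.
Let D : R := 1 + n.+1%:R * C0.
Let e : R := n.+1%:R * 2 `^ (- ((2 + c) * m%:R)).
Let tau : R := 16 * (a * (64 * pi * e)) * (a * (N%:R * D)) ^+ 2.

Let C0_gt0 : 0 < C0. Proof. by rewrite mulr_gt0// pi_gt0. Qed.
Let D_gt0 : 0 < D. Proof. by rewrite ltr_pwDl// mulr_ge0// ltW. Qed.
Let e_gt0 : 0 < e. Proof. by rewrite mulr_gt0// powR_gt0. Qed.
Let N_gt0 : 0 < N%:R :> R. Proof. by rewrite ltr0n expn_gt0. Qed.

Let local_wegner (F : (gidx n -> R) -> 'M[R]_N) (r : R) z :
  coord_measurable_mx F -> (forall h, (F h)^T = F h) ->
  (forall h y, F (upd h (ord0, z, z) y) =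
     F (upd h (ord0, z, z) 0) + (diag_coupling Z * y) *: delta_mx z z) ->
  0 < r ->
  (\int[P]_t (r * sqres (F (g^~ t)) E r z z)%:E <= C0%:E)%E.
Proof.
move=> mF symF Fupd r0.
apply: (le_trans (wegner gauss_g indep_g E mF symF r0 (diag_coupling_gt0 normZ) Fupd)).
rewrite lee_fin /C0 ler_pdivrMr ?(diag_coupling_gt0 normZ)// mulrAC -[leLHS]mul1r.
rewrite ler_wpM2r ?pi_ge0//; have := diag_coupling_ge hc normZ; lra.
Qed.

Let wegnerH r z : 0 < r -> (\int[P]_t (r * sqres (H (g^~ t)) E r z z)%:E <= C0%:E)%E.
Proof.
apply: local_wegner; [exact: measurable_ultra_mx|exact: ultra_mx_sym|].
by move=> h y; exact: ultra_mx_upd_diag.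
Qed.

Let wegnerH0 r z : 0 < r -> (\int[P]_t (r * sqres (H0 (g^~ t)) E r z z)%:E <= C0%:E)%E.
Proof.
apply: local_wegner; [exact: measurable_block_mx_of|exact: block_mx_of_sym|].
by move=> h y; exact: block_mx_of_upd_diag.
Qed.

Let mEntry (F : (gidx n -> R) -> 'M[R]_N) i j : coord_measurable_mx F ->
  measurable_fun setT (fun t => F (g^~ t) i j).
Proof. by move=> mF; exact: (coord_measurable_comp gauss_g (mF i j)). Qed.

Let mS (F : (gidx n -> R) -> 'M[R]_N) r i j : coord_measurable_mx F ->
  (forall h, (F h)^T = F h) -> r != 0 ->
  measurable_fun setT (fun t => sqres (F (g^~ t)) E r i j).
Proof.
by move=> mF symF r0; apply: measurable_sqres => // k l; exact: mEntry.
Qed.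

Let dyad_neq0 k : (2 ^- k : R) != 0. Proof. by rewrite invr_eq0 expf_neq0. Qed.
Let dyad_gt0 k : 0 < (2 ^- k : R). Proof. by rewrite invr_gt0 exprn_gt0. Qed.

Let mW : coord_measurable_mx W.
Proof.
have mS0 (k : nat) : measurable_mx (fun y => sqres (H0 (of_tuple y)) E (2 ^- k)).
  apply: measurable_sqres => // [i j|y]; last exact: block_mx_of_sym.
  exact: measurable_block_mx_of.
move=> i j; rewrite /coord_measurable.
rewrite (_ : _ \o _ = fun y => (1%:M : 'M[R]_N) i j +
    \sum_(k < n.+1) 2 ^- k * sqres (H0 (of_tuple y)) E (2 ^- k) i j).
  by apply: measurable_funD => //; apply: measurable_sum => k; apply: measurable_funM => //; exact: mS0.
apply/funext => y /=; rewrite mxE summxE; congr (_ + _).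
by apply: eq_bigr => k _; rewrite mxE.
Qed.

Let symH0 h : (H0 h)^T = H0 h. Proof. exact: block_mx_of_sym. Qed.
Let symH h : (H h)^T = H h. Proof. exact: ultra_mx_sym. Qed.

Let W_gt0 h z : 0 < W h z z. Proof. exact: abs_resolvent_diag_gt0. Qed.

(** Each dyadic term of [W] is exactly a Wegner quantity at scale 2^-k, which is where the factor
    n+1 in [D] comes from. *)
Let expectation_W z : (\int[P]_t (W (g^~ t) z z)%:E <= D%:E)%E.
Proof.
have -> : (fun t => (W (g^~ t) z z)%:E) = fun t =>
    (1%:E + (\sum_(k < n.+1) 2 ^- k * sqres (H0 (g^~ t)) E (2 ^- k) z z)%:E)%E.
  apply/funext => t; rewrite -EFinD; congr EFin; rewrite mxE mxE eqxx summxE; congr (_ + _).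
  by apply: eq_bigr => k _; rewrite mxE.
have mT k : measurable_fun setT (fun t => 2 ^- k * sqres (H0 (g^~ t)) E (2 ^- k) z z).
  by apply: measurable_funM => //; apply: mS => //; exact: measurable_block_mx_of.
have T0 (k : nat) t : 0 <= 2 ^- k * sqres (H0 (g^~ t)) E (2 ^- k) z z.
  by rewrite mulr_ge0 ?(ltW (dyad_gt0 _))// ltW// sqres_diag_gt0.
rewrite ge0_integralD//; last 2 first.
- by move=> t _; rewrite lee_fin; apply: sumr_ge0 => k _; exact: T0.
- by apply/measurable_EFinP; apply: measurable_sum => k; exact: mT.
rewrite integral_cst//= probability_setT mule1 /D EFinD leeD2l//.
have := @expectation_sum_le _ _ _ P 'I_n.+1 predT
  (fun k t => 2 ^- k * sqres (H0 (g^~ t)) E (2 ^- k) z z) C0.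
rewrite card_ord; apply => // k; exact: wegnerH0.
Qed.

(** Six Markov bounds, each of probability at most 1/a. Off these events the first numerical
    condition gives the spectral gap of the block, the second the smallness of [K] required by
    [sqres_perturbation], and the third turns the bound on the correlator sum into [s]. *)
Lemma correlator_tail_probability (Y : pred 'I_N) :
  0 < a -> 0 < eta -> 0 < eta' -> 2 ^- n <= eta -> 0 <= s ->
  eta' * (a * ((2 ^ m)%:R * C0)) <= 2^-1 -> tau <= 4^-1 ->
  4 * N%:R * eta ^+ 4 * (a * (N%:R * C0) / eta) *
    (4 * (a * C0) / eta' + 32 * tau / eta * (a * D)) <= s ^+ 2 ->
  (P [set t | exists (U : 'M[R]_N) (lam : 'I_N -> R),
       eigenbasis (Hmat c Z g t) U lam /\
       (\sum_(y | Y y) Qcorr U lam (E - eta) (E + eta) x y > s)%R] <= (6 / a)%:E)%E.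
Proof.
move=> a0 eta0 eta'0 eta_n s0 cond1 cond2 cond3.
have etaN0 : eta != 0 by rewrite gt_eqF.
have eta'N0 : eta' != 0 by rewrite gt_eqF.
have mH : coord_measurable_mx H by exact: measurable_ultra_mx.
have mH0 : coord_measurable_mx H0 by exact: measurable_block_mx_of.
set S := [set t | _].
have mSS : measurable S.
  by apply: measurable_correlator_event => i j; exact: (mEntry _ _ mH).
have S_ge0 (F : (gidx n -> R) -> 'M[R]_N) r z t : (forall h, (F h)^T = F h) -> 0 < r ->
    0 <= r * sqres (F (g^~ t)) E r z z.
  by move=> symF r0; rewrite mulr_ge0 ?(ltW r0)// ltW// sqres_diag_gt0// gt_eqF.
have mrS (F : (gidx n -> R) -> 'M[R]_N) r z : coord_measurable_mx F -> (forall h, (F h)^T = F h) -> 0 < r ->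
    measurable_fun setT (fun t => r * sqres (F (g^~ t)) E r z z).
  by move=> mF symF r0; apply: measurable_funM => //; apply: mS => //; rewrite gt_eqF.
pose X1 t := \sum_z eta * sqres (H (g^~ t)) E eta z z.
have [mB1 PB1] :
    measurable [set t | a * (N%:R * C0) <= X1 t] /\
    (P [set t | (a * (N%:R * C0) <= X1 t)%R] <= (a^-1)%:E)%E.
  apply: markov_bound => //.
  - by apply: measurable_sum => z; exact: mrS.
  - by move=> t; apply: sumr_ge0 => z _; exact: S_ge0.
  - by rewrite mulr_gt0.
  - have := @expectation_sum_le _ _ _ P 'I_N predT
      (fun z t => eta * sqres (H (g^~ t)) E eta z z) C0.
    by rewrite card_ord; apply => // [z|z t|z]; [exact: mrS|exact: S_ge0|exact: wegnerH].
pose X2 t := \sum_z W (g^~ t) z z.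
have [mB2 PB2] :
    measurable [set t | a * (N%:R * D) <= X2 t] /\
    (P [set t | (a * (N%:R * D) <= X2 t)%R] <= (a^-1)%:E)%E.
  apply: markov_bound => //.
  - by apply: measurable_sum => z; exact: mEntry.
  - by move=> t; apply: sumr_ge0 => z _; rewrite ltW.
  - by rewrite mulr_gt0.
  - have := @expectation_sum_le _ _ _ P 'I_N predT (fun z t => W (g^~ t) z z) D.
    rewrite card_ord; apply => // [z|z t]; [exact: mEntry|by rewrite ltW].
have [mB3 PB3] : measurable [set t | a * D <= W (g^~ t) x x] /\
    (P [set t | (a * D <= W (g^~ t) x x)%R] <= (a^-1)%:E)%E.
  apply: markov_bound => //; first exact: mEntry.
  by move=> t; rewrite ltW.
pose K h := gaussian_mx (index_coupling c Z) (fun i : gidx n => i.1.2)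
  (fun i : gidx n => i.2) (cross_indices B) h.
have HE h : H h = H0 h + K h by exact: ultra_mx_split.
have symK h : (K h)^T = K h by exact: gaussian_mx_sym.
have trW_gt0 h : 0 < \tr (W h).
  by rewrite /mxtrace (bigD1 x)//= ltr_pwDl// sumr_ge0// => z _; rewrite ltW.
pose X4 t := \tr (W (g^~ t) *m K (g^~ t) *m W (g^~ t) *m K (g^~ t)) / (\tr (W (g^~ t))) ^+ 2.
have [mB4 PB4] : measurable [set t | a * (64 * pi * e) <= X4 t] /\
    (P [set t | (a * (64 * pi * e) <= X4 t)%R] <= (a^-1)%:E)%E.
  apply: markov_bound => //.
  - have mWt : measurable_mx (fun t => W (g^~ t)) by move=> i j; exact: mEntry.
    have mKt : measurable_mx (fun t => K (g^~ t)).
      move=> i j; rewrite (_ : (fun _ => _) = fun t => H (g^~ t) i j - H0 (g^~ t) i j).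
        by apply: measurable_funB; exact: mEntry.
      apply/funext => t; rewrite HE.
        have -> : (H0 (g^~ t) + K (g^~ t)) i j = H0 (g^~ t) i j + K (g^~ t) i j by rewrite mxE.
        by rewrite [RHS]addrC addKr.
    apply: measurable_funM.
      by apply: measurable_sum => i; do 3! apply: measurable_mulmx => //.
    by apply: measurable_inv; apply: measurable_funX; apply: measurable_sum => i.
  - by move=> t; rewrite divr_ge0 ?sqr_ge0// abs_resolvent_tr_ge0.
  - by rewrite !mulr_gt0// pi_gt0.
  - apply: (gaussian_quadratic_expectation gauss_g indep_g (W := W)) => //.
    + by move=> h; exact: abs_resolvent_sym.
    + by move=> h M symM; exact: abs_resolvent_tr_ge0.
    + by rewrite filter_uniq// enum_uniq.
    + by move=> h i y iB; rewrite /W /H0 block_mx_of_upd_cross.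
    + move=> h; apply: cross_coupling_sum_le => // [y z|z]; last by rewrite ltW.
      rewrite /B ltnNge; apply: contra => yz.
      by rewrite !udist_le in yz *; rewrite (eqP yz).
    + by move=> h p q; exact: abs_resolvent_offdiag.
pose X5 t := \sum_(z | B z) eta' * sqres (H0 (g^~ t)) E eta' z z.
have [mB5 PB5] :
    measurable [set t | a * ((2 ^ m)%:R * C0) <= X5 t] /\
    (P [set t | (a * ((2 ^ m)%:R * C0) <= X5 t)%R] <= (a^-1)%:E)%E.
  apply: markov_bound => //.
  - by apply: measurable_sum_cond => z; exact: mrS.
  - by move=> t; apply: sumr_ge0 => z _; exact: S_ge0.
  - by rewrite mulr_gt0// ltr0n expn_gt0.
  - apply: (@le_trans _ _ (#|B|%:R * C0)%:E).
      apply: expectation_sum_le => [z|z t|z]; [exact: mrS|exact: S_ge0|exact: wegnerH0].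
    by rewrite lee_fin ler_wpM2r ?(ltW C0_gt0)// ler_nat card_block.
have [mB6 PB6] : measurable [set t | a * C0 <= eta' * sqres (H0 (g^~ t)) E eta' x x] /\
    (P [set t | (a * C0 <= eta' * sqres (H0 (g^~ t)) E eta' x x)%R] <= (a^-1)%:E)%E.
  apply: markov_bound => //; first exact: mrS.
  - by move=> t; exact: S_ge0.
  - exact: wegnerH0.
move: mB1 PB1 mB2 PB2 mB3 PB3 mB4 PB4 mB5 PB5 mB6 PB6 => /=.
set B1 := [set t | _ <= X1 t]; set B2 := [set t | _ <= X2 t].
set B3 := [set t | _ <= W _ _ _]; set B4 := [set t | _ <= X4 t].
set B5 := [set t | _ <= X5 t]; set B6 := [set t | _ <= eta' * _].
move=> mB1 PB1 mB2 PB2 mB3 PB3 mB4 PB4 mB5 PB5 mB6 PB6.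
have sub : S `<=` B1 `|` (B2 `|` (B3 `|` (B4 `|` (B5 `|` B6)))).
  move=> t [U [lam [UlH big]]]; apply: contrapT.
  move=> /not_orP[/negP]; rewrite -ltNge => b1.
  move=> /not_orP[/negP]; rewrite -ltNge => b2.
  move=> /not_orP[/negP]; rewrite -ltNge => b3.
  move=> /not_orP[/negP]; rewrite -ltNge => b4.
  move=> /not_orP[/negP]; rewrite -ltNge => b5.
  move=> /negP; rewrite -ltNge => b6.
  pose h := g^~ t.
  have Bx : B x by rewrite /B udistxx.
  have gap : sqres (H0 h) E eta x x <= 2 * sqres (H0 h) E eta' x x.
    apply: (@sqres_block_gap _ _ (H0 h) B) => //.
      by move=> y z BB; rewrite /H0 block_mx_ofE (negbTE BB).
    apply: le_trans cond1; rewrite expr2 -mulrA ler_wpM2l ?(ltW eta'0)// mulr_sumr.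
    exact: ltW b5.
  have S0_le : sqres (H0 h) E eta' x x <= a * C0 / eta'.
    by rewrite ler_pdivlMr// mulrC ltW.
  pose tau_t := 16 * \tr (W h *m K h *m W h *m K h).
  have tau_t_le : tau_t <= tau.
    rewrite /tau_t /tau -[leRHS]mulrA ler_wpM2l//.
    have trW2 : 0 < \tr (W h) ^+ 2 by rewrite exprn_gt0.
    have tr_le : \tr (W h) ^+ 2 <= (a * (N%:R * D)) ^+ 2.
      by rewrite ler_sqr ?nnegrE ?(ltW (trW_gt0 _)) ?mulr_ge0 ?(ltW a0) ?(ltW D_gt0)// ltW.
    have : X4 t * \tr (W h) ^+ 2 = \tr (W h *m K h *m W h *m K h).
      by rewrite /X4 divfK// gt_eqF.
    move=> <-; apply: ler_pM => //; [|exact: ltW trW2|exact: ltW b4].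
    by rewrite divr_ge0 ?sqr_ge0// abs_resolvent_tr_ge0.
  have SH_le : sqres (H h) E eta x x <= 4 * (a * C0) / eta' + 32 * tau / eta * (a * D).
    rewrite HE; apply: (le_trans (sqres_perturbation x (symH0 h) (symK h) eta0 eta_n _)).
      exact: le_trans tau_t_le cond2.
    rewrite -/tau_t; apply: lerD; first by move: gap S0_le; lra.
    have tau_t0 : 0 <= tau_t by rewrite mulr_ge0// abs_resolvent_tr_ge0.
    apply: ler_pM; [|exact: ltW (W_gt0 _ _)| |exact: ltW b3].
      by rewrite divr_ge0 ?(ltW eta0)// mulr_ge0.
    by rewrite ler_pM2r ?invr_gt0// ler_pM2l.
  have trH_le : \tr (sqres (H h) E eta) <= a * (N%:R * C0) / eta.
    by rewrite ler_pdivlMr// mulrC /mxtrace mulr_sumr ltW.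
  have := correlator_sum_le E x Y (UlH : eigenbasis (H h) U lam) eta0; apply/negP; rewrite -ltNge.
  apply: (@le_lt_trans _ _ (s ^+ 2)); last first.
    by rewrite ltr_sqr ?nnegrE// ltW// (le_lt_trans s0).
  apply: le_trans cond3; apply: ler_pM => //.
  - apply: mulr_ge0; last by apply: sumr_ge0 => z _; rewrite ltW// sqres_diag_gt0.
    by rewrite !mulr_ge0 ?exprn_ge0// ltW.
  - by rewrite ltW// sqres_diag_gt0.
  - by rewrite ler_wpM2l// !mulr_ge0 ?exprn_ge0// ltW.
have m56 := measurableU _ _ mB5 mB6; have m46 := measurableU _ _ mB4 m56.
have m36 := measurableU _ _ mB3 m46; have m26 := measurableU _ _ mB2 m36.
have m16 := measurableU _ _ mB1 m26.
apply: (le_trans (le_measure P _ _ sub)); rewrite ?inE//.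
have -> : 6 / a = a^-1 + (a^-1 + (a^-1 + (a^-1 + (a^-1 + a^-1)))) by ring.
rewrite !EFinD.
apply: (le_trans (measureU2 P mB1 m26)); apply: leeD => //.
apply: (le_trans (measureU2 P mB2 m36)); apply: leeD => //.
apply: (le_trans (measureU2 P mB3 m46)); apply: leeD => //.
apply: (le_trans (measureU2 P mB4 m56)); apply: leeD => //.
by apply: (le_trans (measureU2 P mB5 mB6)); apply: leeD.
Qed.

End TailProbability.

(** * Choice of the scales *)

Section Scales.
Context {R : realType}.

Definition pow2 (n : nat) (t : R) : R := 2 `^ (t * n%:R).

Lemma pow2_gt0 n t : 0 < pow2 n t. Proof. exact: powR_gt0. Qed.

Lemma pow2D n t u : pow2 n (t + u) = pow2 n t * pow2 n u.
Proof. by rewrite /pow2 mulrDl powRD// pnatr_eq0 implybT. Qed.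

Lemma pow2N n t : pow2 n (- t) = (pow2 n t)^-1.
Proof. by rewrite /pow2 mulNr powRN. Qed.

Lemma pow2_le n t u : t <= u -> pow2 n t <= pow2 n u.
Proof. by move=> tu; apply: ler_powR; rewrite ?ler1n// ler_wpM2r. Qed.

Lemma pow2_1 n : pow2 n 1 = 2 ^+ n.
Proof. by rewrite /pow2 mul1r powR_mulrn. Qed.

Lemma pow2_X n t k : pow2 n t ^+ k = pow2 n (t *+ k).
Proof.
elim: k => [|k IH]; first by rewrite mulr0n /pow2 mul0r powRr0.
by rewrite exprS IH -pow2D mulrS.
Qed.

Let ln2_gt0 : 0 < ln (2 : R). Proof. by rewrite ln_gt0// ltr1n. Qed.

Lemma pow2_ge n t : 1 + t * n%:R * ln 2 <= pow2 n t.
Proof. by rewrite /pow2 /powR pnatr_eq0 /= expR_ge1Dx. Qed.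

(** Used to absorb the polynomial factors in n coming from the number of levels. *)
Lemma natS_le_pow2 t : 0 < t -> exists2 C : R, 0 < C & forall n, n.+1%:R <= C * pow2 n t.
Proof.
move=> t0; have tl : 0 < t * ln 2 by rewrite mulr_gt0.
exists (1 + (t * ln 2)^-1) => [|n]; first by rewrite addr_gt0// invr_gt0.
apply: (@le_trans _ _ ((1 + (t * ln 2)^-1) * (1 + t * n%:R * ln 2))); last first.
  by rewrite ler_wpM2l ?pow2_ge// addr_ge0// invr_ge0 ltW.
have -> : (1 + (t * ln 2)^-1) * (1 + t * n%:R * ln 2) =
    1 + n%:R + (t * n%:R * ln 2 + (t * ln 2)^-1).
  by field; rewrite !gt_eqF.
by rewrite -nat1r lerDl addr_ge0 ?invr_ge0 ?(ltW tl)// mulr_ge0 ?(ltW ln2_gt0)// mulr_ge0// ltW.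
Qed.

Lemma le_pow2_near C t : 0 < t -> exists n0 : nat, forall n, (n0 <= n)%N -> C <= pow2 n t.
Proof.
move=> t0; have tl : 0 < t * ln 2 by rewrite mulr_gt0.
exists (Num.bound `|C / (t * ln 2)|) => n n0n.
apply: le_trans (pow2_ge n t).
have h : C / (t * ln 2) <= n%:R.
  apply: (@le_trans _ _ (Num.bound `|C / (t * ln 2)|)%:R); last by rewrite ler_nat.
  by apply: (le_trans (ler_norm _)); apply/ltW/archi_boundP.
move: h; rewrite ler_pdivrMr// => h; lra.
Qed.

End Scales.

Ltac positivity := repeat match goal with
  | |- is_true (_ < _ * _) => apply: mulr_gt0
  | |- is_true (_ < _ ^+ _) => apply: exprn_gt0
  | |- is_true (_ < _^-1) => rewrite invr_gt0
  | |- is_true (_ < _ + _) => apply: addr_gt0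
  | |- is_true (_ < _%:R) => rewrite ltr0n ?expn_gt0; reflexivity
  | |- is_true (_ < 1) => exact: ltr01
  | |- _ => first [assumption | exact: pow2_gt0]
  end.

Lemma eventually_conditions (R : realType) (c : R) : 0 < c ->
  exists (q n0 : nat) (al : R), [/\ (0 < q)%N, 0 < al &
  forall n, (n0 <= n)%N ->
    let m := (n - n %/ q)%N in
    let eta := pow2 n (- (1 - al)) in
    let eta' := pow2 n (- (1 - 6 * al)) in
    let a := pow2 n al in
    let D := 1 + n.+1%:R * (2 * pi) in
    let e := n.+1%:R * 2 `^ (- ((2 + c) * m%:R)) in
    let tau := 16 * (a * (64 * pi * e)) * (a * ((2 ^ n)%N%:R * D)) ^+ 2 in
    [/\ eta' * (a * ((2 ^ m)%:R * (2 * pi))) <= 2^-1, tau <= 4^-1 &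
     4 * (2 ^ n)%N%:R * eta ^+ 4 * (a * ((2 ^ n)%N%:R * (2 * pi)) / eta) *
       (4 * (a * (2 * pi)) / eta' + 32 * tau / eta * (a * D)) <=
       pow2 n (- (al / 4)) ^+ 2]].
Proof.
move=> c0.
(* [q] is large enough that shrinking the block exponent by 1/q costs at most half of c in the
   variance of [K]. *)
pose q := (Num.bound (2 * (2 + c) / c)).+1.
have q0 : 0 < q%:R :> R by rewrite ltr0n.
have qc : 2 * (2 + c) <= c * q%:R.
  rewrite [leRHS]mulrC -ler_pdivrMr// (@le_trans _ _ (Num.bound (2 * (2 + c) / c))%:R)//.
    apply/ltW/archi_boundP; rewrite divr_ge0 ?mulr_ge0 ?addr_ge0// ltW//.
  by rewrite ler_nat.
(* Chosen so that 8 al = 1/q: the block has about N^(1-8al) points, two powers of N^al beyond the 6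
   al of eta', one of which pays for the Markov factor. *)
pose al : R := (8 * q%:R)^-1.
have al0 : 0 < al by rewrite invr_gt0 mulr_gt0.
have alq : 8 * al = q%:R^-1 by rewrite /al; field; rewrite gt_eqF.
have alc : 16 * al * (2 + c) <= c.
  have -> : 16 * al * (2 + c) = 2 * (2 + c) / q%:R by rewrite /al; field; rewrite gt_eqF.
  by rewrite ler_pdivrMr.
have [Ca Ca0 CaP] := natS_le_pow2 al0.
have pi0 : 0 < pi :> R := pi_gt0 R.
pose C0 : R := 2 * pi.
have C00 : 0 < C0 by rewrite mulr_gt0.
pose C1 := 1024 * pi * (1 + C0) ^+ 2 * Ca ^+ 3.
have C10 : 0 < C1 by rewrite /C1; positivity.
pose C2 := 16 * C0 ^+ 2 + 128 * C0 * C1 * (1 + C0) * Ca.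
have al2 : 0 < al / 2 by rewrite divr_gt0.
(* Every condition below holds with a spare factor of at least N^(-al); half of it, N^(-al/2),
   absorbs all constants. *)
have [n1 n1P] := le_pow2_near (4 * C0 + 4 * C1 + C2) al2.
exists q, n1, al; split=> // n n1n m eta eta' a D e tau.
have C20 : 0 <= C2.
  by apply: ltW; rewrite /C2; positivity.
have big : 4 * C0 + 4 * C1 + C2 <= pow2 n (al / 2) by exact: n1P.
have P0 t := pow2_gt0 n (t : R).
have NE : (2 ^ n)%N%:R = pow2 n 1 :> R by rewrite pow2_1 natrX.
have mE : m%:R = n%:R - (n %/ q)%:R :> R by rewrite /m natrB// leq_div.
have div_le : (n %/ q)%:R <= n%:R / q%:R :> R.
  by rewrite ler_pdivlMr// -natrM ler_nat leq_trunc_div.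
have div_ge : n%:R / q%:R <= (n %/ q)%:R + 1 :> R.
  rewrite ler_pdivrMr// natr1 -natrM ler_nat ltnW//.
  by rewrite mulSn addnC {1}(divn_eq n q) ltn_add2l ltn_pmod.
(* Rounding down in [n %/ q] can at most double the block. *)
have m_up : m%:R <= (1 - 8 * al) * n%:R + 1 by rewrite mE alq; lra.
have m_lo : (1 - 8 * al) * n%:R <= m%:R by rewrite mE alq; lra.
have two_m : (2 ^ m)%N%:R <= 2 * pow2 n (1 - 8 * al) :> R.
  rewrite natrX -powR_mulrn// -[X in X * _]powRr1// -powRD ?pnatr_eq0 ?implybT//.
  by apply: ler_powR; rewrite ?ler1n// addrC.
have ee : 2 `^ (- ((2 + c) * m%:R)) <= pow2 n (- ((2 + c) * (1 - 8 * al))).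
  apply: ler_powR; rewrite ?ler1n// mulNr lerN2 -mulrA ler_wpM2l//.
  by rewrite addr_ge0// ltW.
have n1_le : n.+1%:R <= Ca * pow2 n al by exact: CaP.
have D_le : D <= (1 + C0) * (Ca * pow2 n al).
  apply: (@le_trans _ _ ((1 + C0) * n.+1%:R)); last by rewrite ler_wpM2l// addr_ge0// ltW.
  rewrite /D -/C0 mulrDl mul1r [C0 * _]mulrC lerD2r.
  by rewrite ler1n.
have D0 : 0 < D by rewrite /D ltr_wpDr// mulr_ge0// ltW.
have e_le : e <= Ca * pow2 n al * pow2 n (- ((2 + c) * (1 - 8 * al))).
  by apply: ler_pM => //; exact: powR_ge0.
have e0 : 0 < e by rewrite /e mulr_gt0// powR_gt0.
have tau_le : tau <= C1 * pow2 n (- (10 * al)).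
  apply: (@le_trans _ _ (16 * (a * (64 * pi * (Ca * pow2 n al * pow2 n (- ((2 + c) * (1 - 8 * al)))))) *
      (a * (pow2 n 1 * ((1 + C0) * (Ca * pow2 n al)))) ^+ 2)).
    rewrite /tau NE; apply: ler_pM.
    - by apply: ltW; positivity.
    - exact: sqr_ge0.
    - by rewrite ler_pM2l// ler_pM2l ?P0// ler_pM2l//; positivity.
    - rewrite ler_sqr ?nnegrE; last 2 first.
      + by apply: ltW; positivity.
      + by apply: ltW; positivity.
      by rewrite ler_pM2l ?P0// ler_pM2l ?P0.
  have -> : 16 * (a * (64 * pi * (Ca * pow2 n al * pow2 n (- ((2 + c) * (1 - 8 * al)))))) *
      (a * (pow2 n 1 * ((1 + C0) * (Ca * pow2 n al)))) ^+ 2 =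
      C1 * (a ^+ 3 * pow2 n al ^+ 3 * pow2 n 1 ^+ 2 * pow2 n (- ((2 + c) * (1 - 8 * al)))).
    by rewrite /C1; ring.
  (* The exponent is 6 al - c + 8 al (2 + c). It is at most -10 al because 16 al <= 8 al (2 + c) and
     [alc] bounds 16 al (2 + c) by c. *)
  rewrite ler_pM2l// /a !pow2_X -!pow2D; apply: pow2_le.
  have : 0 <= al * c by rewrite mulr_ge0// ltW.
  nra.
have a0 : 0 < a := P0 _.
split.
- apply: (@le_trans _ _ (eta' * (a * (2 * pow2 n (1 - 8 * al) * C0)))).
    by rewrite ler_pM2l ?P0// ler_pM2l// ler_pM2r.
  have -> : eta' * (a * (2 * pow2 n (1 - 8 * al) * C0)) =
     2 * C0 * (eta' * a * pow2 n (1 - 8 * al)) by ring.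
  rewrite /eta' /a -!pow2D.
  apply: (@le_trans _ _ (2 * C0 * pow2 n (- (al / 2)))).
    by rewrite ler_pM2l ?mulr_gt0//; apply: pow2_le; lra.
  by rewrite pow2N ler_pdivrMr ?P0//; lra.
- apply: (le_trans tau_le); apply: (@le_trans _ _ (C1 * pow2 n (- (al / 2)))).
    by rewrite ler_pM2l//; apply: pow2_le; lra.
  by rewrite pow2N ler_pdivrMr ?P0//; lra.
- rewrite NE; apply: (@le_trans _ _ (4 * pow2 n 1 * eta ^+ 4 * (a * (pow2 n 1 * C0) / eta) *
     (4 * (a * C0) / eta' + 32 * (C1 * pow2 n (- (10 * al))) / eta *
        (a * ((1 + C0) * (Ca * pow2 n al)))))).
    rewrite ler_pM2l; last by positivity.
    rewrite lerD2l; apply: ler_pM.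
    + by apply: ltW; rewrite /tau; positivity.
    + by apply: ltW; positivity.
    + by rewrite ler_pM2r ?invr_gt0 ?P0// ler_pM2l.
    + by rewrite ler_pM2l.
  have eta0 : eta != 0 by rewrite gt_eqF ?P0.
  have eta'0 : eta' != 0 by rewrite gt_eqF ?P0.
  have -> : 4 * pow2 n 1 * eta ^+ 4 * (a * (pow2 n 1 * C0) / eta) *
     (4 * (a * C0) / eta' + 32 * (C1 * pow2 n (- (10 * al))) / eta *
        (a * ((1 + C0) * (Ca * pow2 n al)))) =
     16 * C0 ^+ 2 * (a ^+ 2 * pow2 n 1 ^+ 2 * eta ^+ 3 * eta'^-1) +
     128 * C0 * C1 * (1 + C0) * Ca * (a ^+ 2 * pow2 n 1 ^+ 2 * eta ^+ 2 *
       pow2 n (- (10 * al)) * pow2 n al).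
    by field; rewrite eta0 eta'0.
  (* The two terms have exponents -al (block gap) and -5 al (perturbation). *)
  rewrite /a /eta /eta' -pow2N !pow2_X -!pow2D.
  apply: (@le_trans _ _ (C2 * pow2 n (- al))).
    rewrite /C2 [leRHS]mulrDl; apply: lerD.
      rewrite ler_pM2l; first by apply: pow2_le; lra.
      by positivity.
    rewrite ler_pM2l; first by apply: pow2_le; lra.
    by positivity.
  have -> : - (al / 4) *+ 2 = al / 2 - al by field.
  rewrite pow2D ler_pM2r ?P0//; lra.
Qed.

Theorem theorem1p2 (R : realType) (c E : R) (hc : 0 < c) :
  exists (w mu kappa C : R) (m : nat -> int),
    [/\ 0 < w /\ 0 < mu, 0 < kappa /\ 0 < C,
        (forall K : int, exists N0 : nat, forall n : nat,
             (N0 <= n)%N -> K <= n%:Z - m n) &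
        forall (n : nat) (Z : R) (d : measure_display) (T : measurableType d)
               (P : probability T R) (g : gidx n -> T -> R),
          is_normalization n c Z ->
          (forall i, std_gaussian P (g i)) ->
          mutually_independent P g ->
          forall x : 'I_(2 ^ n),
            (P [set t | exists (U : 'M[R]_(2 ^ n)) (lam : 'I_(2 ^ n) -> R),
                  eigenbasis (Hmat c Z g t) U lam /\
                  (\sum_(y < 2 ^ n | ~~ in_ball (m n) x y)
                     Qcorr U lam (E - 2 `^ (- ((1 - w) * n%:R)))
                                 (E + 2 `^ (- ((1 - w) * n%:R))) x y
                  > 2 `^ (- (mu * n%:R)))%R]
             <= (C * 2 `^ (- (kappa * n%:R)))%:E)%E].
Proof.
have [q [n0 [al [q0 al0 cond]]]] := eventually_conditions hc.
(* The squared correlator sum is of order N^(-al/2) once constants are absorbed, hence mu = al/4.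
   The 6 counts the bad events, and the second summand of C makes the bound at least 1 for n <
   n0. *)
exists al, (al / 4), al, (6 + pow2 n0 al), (fun n => (n - n %/ q)%N%:Z); split.
- by rewrite divr_gt0.
- by rewrite al0 addr_gt0// pow2_gt0.
- move=> K; exists (`|K| * q)%N => n Kn.
  have -> : n%:Z - (n - n %/ q)%N%:Z = (n %/ q)%N%:Z.
    by rewrite -{1}(subnK (leq_div n q)) PoszD addrAC subrr add0r.
  apply: (le_trans (ler_norm K)).
  by rewrite -abszE lez_nat leq_divRL.
- move=> n Z d T P g normZ gauss_g indep_g x.
  have powE (t : R) : 2 `^ (- (t * n%:R)) = pow2 n (- t) by rewrite /pow2 mulNr.
  rewrite !powE; have [n0n|nn0] := leqP n0 n.
    have [c1 c2 c3] := cond n n0n.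
    apply: (@le_trans _ _ (6 / pow2 n al)%:E).
      apply: (correlator_tail_probability (m := (n - n %/ q)%N) (a := pow2 n al)
        (eta := pow2 n (- (1 - al))) (eta' := pow2 n (- (1 - 6 * al)))
        (s := pow2 n (- (al / 4))) E hc normZ gauss_g indep_g x
        (fun y => ~~ in_ball (n - n %/ q)%N%:Z x y)) => //;
        rewrite ?pow2_gt0// ?(ltW (pow2_gt0 _ _))//.
      by rewrite -pow2_1 -pow2N; apply: pow2_le; lra.
    rewrite lee_fin pow2N ler_wpM2r ?invr_ge0 ?(ltW (pow2_gt0 _ _))//.
    by rewrite lerDl ltW// pow2_gt0.
  apply: (@le_trans _ _ 1%E).
    apply: probability_le1; apply: measurable_correlator_event => i j.
    exact: (coord_measurable_comp gauss_g (measurable_ultra_mx c Z i j)).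
  rewrite lee_fin pow2N ler_pdivlMr ?pow2_gt0// mul1r.
  apply: (@le_trans _ _ (pow2 n0 al)); last by rewrite lerDr.
  by apply: ler_powR; rewrite ?ler1n// ler_wpM2l ?(ltW al0)// ler_nat ltnW.
Qed.
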